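(* Let $\mu$ be a nonzero bounded $\mathbb{C}$-valued Borel measure on $[a,b]$, let $n\in\mathbb{N}$, let $k$ be an integer with $0\leq k<n$ and let $\gamma\in\mathbb{C}$. Assume that $$\int_{[a,b]}x^i\,d\mu(x)=0\qquad(i\in\{0,\dots,k-1\}),$$ $$\int_{[a,b]}\exp\Big(\sqrt[n-k]{\gamma}\,\exp\big(\tfrac{2j\pi}{n-k}\boldsymbol{i}\big)x\Big)\,d\mu(x)=0\qquad(j\in\{0,\dots,n-k-1\}).$$ Define $g:[a,b]\to\mathbb{C}$ by $$g(t):=\int_{[t,b]}\zeta'_{n,k,\gamma}(x-t)\,d\mu(x).$$ Then, for all $f\in\mathscr{C}^n_{\mathbb{C}}([a,b])$ and $p,q\in[1,\infty]$ with $\frac1p+\frac1q=1$, $$\bigg|\int_{[a,b]}f(x)\,d\mu(x)\bigg|\leq\|f^{(n)}-\gamma f^{(k)}\|_p\cdot\|g\|_q.$$ If, in addition, $\gamma\in\mathbb{R}$, $\mu$ is a real-valued measure and both $g$ and $f^{(n)}-\gamma f^{(k)}$ are nonnegative (or both are nonpositive) on $[a,b]$, then $$\int_{[a,b]}f(x)\,d\mu(x)\geq0.$$ If $g$ and $f^{(n)}-\gamma f^{(k)}$ have opposite signs over $[a,b]$ (one is nonnegative and the other is nonpositive), then this inequality reverses.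
   Context: $[a,b]$ is a compact interval; $\mathscr{C}^n_{\mathbb{C}}([a,b])$ is the space of $n$ times continuously differentiable complex-valued functions on $[a,b]$. $\boldsymbol{i}$ is the imaginary unit, and $\sqrt[n-k]{\gamma}$ denotes the root of order $(n-k)$ of $\gamma$ with the smallest nonnegative argument in the interval $[0,2\pi)$. The function $\zeta_{n,k,\gamma}:\mathbb{R}\to\mathbb{C}$ is defined by $$\zeta_{n,k,\gamma}(t):=\sum_{i=0}^\infty\frac{\gamma^i t^{i(n-k)+n}}{(i(n-k)+n)!}$$ (here $i$ is a summation index). For a Lebesgue measurable $f:[a,b]\to\mathbb{C}$, $\|f\|_p:=\big(\int_{[a,b]}|f(t)|^p\,dt\big)^{1/p}$ if $p\in[1,\infty)$, and $\|f\|_\infty$ is the essential supremum of $|f|$ on $[a,b]$.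
   Formalization: The formal theorem adds the assumption that γ ≠ 0 or n = 1; for γ = 0 and n ≥ 2 the claim is false (take μ an (n−1)-th finite difference and f(x) = x^{n−1}: the right side is 0 but ∫f dμ ≠ 0). *)

(* Defs.v *)
From HB Require Import structures.
From mathcomp Require Import all_boot all_order all_algebra.
From mathcomp Require Import complex.
From mathcomp Require Import all_classical all_reals all_analysis.

Set Implicit Arguments.
Unset Strict Implicit.
Unset Printing Implicit Defensive.

Import Order.TTheory GRing.Theory Num.Theory.
Import numFieldNormedType.Exports.

#[global] Open Scope classical_set_scope.
#[global] Open Scope ring_scope.

(* The library puts a topology on [R[i]^o] (the plane with the modulus norm)
   rather than on [R[i]] itself, hence the casts in the limits below. The order
   on [R[i]] is partial: [0 <= z] means that [z] is real and nonnegative. *)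

Definition cmod (R : realType) (z : R[i]) : R := ComplexField.Normc.normc z.

Definition cexp (R : realType) (z : R[i]) : R[i] :=
  Complex (expR (complex.Re z) * cos (complex.Im z))
          (expR (complex.Re z) * sin (complex.Im z)).

Section derivative.
Context (R : realType).
Implicit Types (D : set R) (f : R -> R[i]) (s t : R).

Definition diff_quotient f t s : R[i]^o := (f s - f t) / (s - t)%:C%C.

(* Derivatives are taken relative to [D]: on [D = [a, b]] they are one-sided at
   the endpoints; on [D = setT] they are the usual ones. *)
Definition cderivable D f t : Prop :=
  cvg (diff_quotient f t s @[s --> within D t^']).

Definition cderiv D f t : R[i] :=
  lim (diff_quotient f t s @[s --> within D t^']).

Definition cderivn D (i : nat) f : R -> R[i] := iter i (cderiv D) f.

Definition Cn_on D (n : nat) f : Prop :=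
  (forall (i : nat) t, (i < n)%N -> D t -> cderivable D (cderivn D i f) t) /\
  {within D, continuous (cderivn D n f : R -> R[i]^o)}.

End derivative.

Record cmeasure (R : realType) := CMeasure {
  cmeas :> set (measurableTypeR R) -> R[i] ;
  cmeas0 : cmeas set0 = 0 ;
  cmeas_sigma_additive : forall F : (set (measurableTypeR R))^nat,
    (forall i, measurable (F i)) -> trivIset setT F ->
    ((\sum_(0 <= i < n) cmeas (F i) : R[i]^o) @[n --> \oo]
       --> (cmeas (\bigcup_i F i) : R[i]^o)) ;
  cmeas_bounded : exists M : R, forall A : set (measurableTypeR R),
    measurable A -> cmod (cmeas A) <= M }.

Lemma cvg_ReIm (R : realType) (u : (R[i]^o)^nat) (l : R[i]^o) :
  u n @[n --> \oo] --> l ->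
  complex.Re (u n) @[n --> \oo] --> complex.Re l /\
  complex.Im (u n) @[n --> \oo] --> complex.Im l.
Proof.
move=> /cvgrPdist_lt ul; split; apply/cvgrPdist_lt => e e0.
- have e0' : 0 < (e%:C%C : R[i]) by rewrite ltcR.
  apply: filterS (ul _ e0') => n /=; rewrite -ltcR; apply: le_lt_trans.
  by rewrite -raddfB; exact: normc_ge_Re.
- have e0' : 0 < (e%:C%C : R[i]) by rewrite ltcR.
  apply: filterS (ul _ e0') => n /=; rewrite -ltcR; apply: le_lt_trans.
  rewrite -raddfB -[leRHS]mul1r.
  have -> : (1 : R[i]) = `|(Complex 0 1 : R[i])|.
    by rewrite normc_def /= expr0n expr1n /= add0r sqrtr1.
  rewrite -normrM; apply: le_trans (normc_ge_Re _).
  case: (l - u n) => x y /=.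
  by rewrite mul0r mul1r sub0r normrN.
Qed.

Section real_imaginary_charges.
Context (R : realType) (mu : cmeasure R).

Definition cmeas_Re (A : set (measurableTypeR R)) : \bar R :=
  (complex.Re (mu A))%:E.
Definition cmeas_Im (A : set (measurableTypeR R)) : \bar R :=
  (complex.Im (mu A))%:E.

Let Re0 : cmeas_Re set0 = 0%E.
Proof. by rewrite /cmeas_Re cmeas0. Qed.

Let Im0 : cmeas_Im set0 = 0%E.
Proof. by rewrite /cmeas_Im cmeas0. Qed.

Let Re_fin A : measurable A -> cmeas_Re A \is a fin_num.
Proof. by []. Qed.

Let Im_fin A : measurable A -> cmeas_Im A \is a fin_num.
Proof. by []. Qed.

Let Re_sigma : semi_sigma_additive cmeas_Re.
Proof.
move=> F mF tF _; have [+ _] := cvg_ReIm (cmeas_sigma_additive (c := mu) mF tF).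
move=> h; rewrite /cmeas_Re.
under eq_fun do rewrite sumEFin.
apply: cvg_EFin; first exact: nearW.
by under eq_fun do rewrite /= -raddf_sum.
Qed.

Let Im_sigma : semi_sigma_additive cmeas_Im.
Proof.
move=> F mF tF _; have [_ +] := cvg_ReIm (cmeas_sigma_additive (c := mu) mF tF).
move=> h; rewrite /cmeas_Im.
under eq_fun do rewrite sumEFin.
apply: cvg_EFin; first exact: nearW.
by under eq_fun do rewrite /= -raddf_sum.
Qed.

HB.instance Definition _ := isCharge.Build _ _ R cmeas_Re Re0 Re_fin Re_sigma.
HB.instance Definition _ := isCharge.Build _ _ R cmeas_Im Im0 Im_fin Im_sigma.

End real_imaginary_charges.

Section integration.
Context (R : realType).
Local Notation T := (measurableTypeR R).

Definition hahn_pair (nu : {charge set T -> \bar R}) :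
    {PN : set T * set T | hahn_decomposition nu PN.1 PN.2} :=
  let P := cid (Hahn_decomposition nu) in
  let N := cid (projT2 P) in
  exist _ (projT1 P, projT1 N) (projT2 N).

(* The integral does not depend on the chosen Hahn decomposition. *)
Definition charge_integral (nu : {charge set T -> \bar R}) (D : set T)
    (h : T -> R) : R :=
  \int[jordan_pos (svalP (hahn_pair nu))]_(x in D) h x -
  \int[jordan_neg (svalP (hahn_pair nu))]_(x in D) h x.

Definition cintegral (mu : cmeasure R) (D : set T) (h : T -> R[i]) : R[i] :=
  let re x := complex.Re (h x) in
  let im x := complex.Im (h x) in
  Complex (charge_integral (cmeas_Re mu) D re - charge_integral (cmeas_Im mu) D im)
          (charge_integral (cmeas_Re mu) D im + charge_integral (cmeas_Im mu) D re).

Definition cLnorm (a b : R) (p : \bar R) (h : R -> R[i]) : \bar R :=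
  Lnorm (mrestr (@lebesgue_measure R) (measurable_itv `[a, b])) p
    (fun t : T => (cmod (h t))%:E).

End integration.

Definition zeta (R : realType) (n k : nat) (gamma : R[i]) (t : R) : R[i] :=
  lim ((series (fun i : nat =>
    gamma ^+ i * t%:C%C ^+ (i * (n - k) + n) / ((i * (n - k) + n)`!)%:R)
      : (R[i]^o)^nat) @ \oo).

Definition gfun (R : realType) (mu : cmeasure R) (b : R) (n k : nat)
    (gamma : R[i]) (t : R) : R[i] :=
  cintegral mu `[t, b] (fun x => cderiv setT (zeta n k gamma) (x - t)).

(* Main.v *)
Require Import Defs.
From mathcomp Require Import all_boot all_order all_algebra.
From mathcomp Require Import complex ring lra.
From mathcomp Require Import all_classical all_reals all_analysis.
From mathcomp Require Import measurable_realfun.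
Import Order.TTheory GRing.Theory Num.Theory.
Import numFieldNormedType.Exports.

Set Implicit Arguments.
Unset Strict Implicit.
Unset Printing Implicit Defensive.

(** Write [m = n - k], [L f = f^(n) - gamma f^(k)] and [E_j = zeta^(j)], so that
    [E_1] is the Green function of [L] at [0]: [E_j 0] is [1] if [j = n] and [0]
    if [1 <= j < n], and [E_(n+1) = gamma E_(k+1)]. Integrating by parts,
    [f x] is the sum of [\int_a^x E_1 (x - t) L f t dt] and of a combination of
    the [E_j (x - a)], [1 <= j <= n], which lie in the span of the monomials
    [x ^ i], [i < k], and of the [exp (lam x)] with [lam ^ m = gamma], hence
    have integral [0] for [mu]. Fubini's theorem then gives
    [\int f dmu = \int_a^b L f t * g t dt]; the bound is Hoelder's inequality
    and the sign statements are immediate. *)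

(** * Complex limits and derivatives *)

(** The function [cexp] is built from real exponentials, cosines and sines, while [zeta] is a power
    series. The bridge between them is the exponential minus its Taylor polynomial, a remainder
    bounded by the mean value theorem on real and imaginary parts. Averaging such tails over the
    finitely many roots of [gamma] gives [zeta] and all its derivatives in closed form, so that no
    series is ever differentiated term by term. On the measure side, [mu] splits into the Jordan
    parts of its real and imaginary charges, that is four finite positive measures, and the
    integrands are kept bounded and measurable on [[a, b]], which makes integrability automatic.
    Outside [[a, b]] the function [f] is arbitrary: its derivatives are one-sided at the endpoints,
    and functions are cut off by zero whenever a theorem is about the whole space. *)

Section complex_modulus.
Context (R : realType).
Implicit Types z w : R[i].

Lemma ReM z w : complex.Re (z * w) =
  complex.Re z * complex.Re w - complex.Im z * complex.Im w.
Proof. by case: z w => [? ?] [? ?]. Qed.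

Lemma ImM z w : complex.Im (z * w) =
  complex.Re z * complex.Im w + complex.Im z * complex.Re w.
Proof. by case: z w => [? ?] [? ?]. Qed.

Lemma Re_scale z (r : R) : complex.Re (z / r%:C%C) = complex.Re z / r.
Proof. by rewrite -fmorphV; case: z => x y /=; rewrite mulr0 subr0. Qed.

Lemma Im_scale z (r : R) : complex.Im (z / r%:C%C) = complex.Im z / r.
Proof. by rewrite -fmorphV; case: z => x y /=; rewrite mulr0 add0r mulrC. Qed.

Lemma complex_ge0E z : (0 <= z) = (complex.Im z == 0) && (0 <= complex.Re z).
Proof. by rewrite lecE /=. Qed.

Lemma cmod_sqr z : cmod z ^+ 2 = complex.Re z ^+ 2 + complex.Im z ^+ 2.
Proof. by case: z => x y; rewrite /cmod /= sqr_sqrtr// addr_ge0// sqr_ge0. Qed.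

Lemma cmod_ge0 z : 0 <= cmod z.
Proof. by case: z => x y; exact: sqrtr_ge0. Qed.

Lemma cmodM z w : cmod (z * w) = cmod z * cmod w.
Proof. exact: ComplexField.Normc.normcM. Qed.

Lemma Re_le_cmod z : `|complex.Re z| <= cmod z.
Proof. by rewrite -lecR; exact: normc_ge_Re. Qed.

Lemma Im_le_cmod z : `|complex.Im z| <= cmod z.
Proof.
case: z => x y; have := Re_le_cmod (Complex y x).
by rewrite /cmod /= addrC.
Qed.

(** The l1 norm of the plane: real and imaginary parts can be bounded one at a time, without square
    roots, and it is still submultiplicative. *)
Definition cnorm1 z : R := `|complex.Re z| + `|complex.Im z|.

Lemma cnorm1_ge0 z : 0 <= cnorm1 z.
Proof. by rewrite addr_ge0. Qed.

Lemma cnorm1D z w : cnorm1 (z + w) <= cnorm1 z + cnorm1 w.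
Proof.
case: z w => [x y] [u v]; rewrite /cnorm1 /=.
have := ler_normD x u; have := ler_normD y v; lra.
Qed.

Lemma cnorm1M z w : cnorm1 (z * w) <= cnorm1 z * cnorm1 w.
Proof.
case: z w => [x y] [u v]; rewrite /cnorm1 /= mulrDl !mulrDr.
have h1 : `|x * u - y * v| <= `|x| * `|u| + `|y| * `|v|.
  by rewrite -!normrM ler_normB.
have h2 : `|x * v + y * u| <= `|x| * `|v| + `|y| * `|u|.
  by rewrite -!normrM ler_normD.
lra.
Qed.

Lemma cmod_le_cnorm1 z : cmod z <= cnorm1 z.
Proof.
rewrite -(ger0_norm (cnorm1_ge0 z)) -(ger0_norm (cmod_ge0 z)) -!sqrtr_sqr.
rewrite ler_wsqrtr// cmod_sqr /cnorm1 sqrrD !real_normK ?num_real//.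
by rewrite addrAC lerDl mulrn_wge0// mulr_ge0.
Qed.

End complex_modulus.

Section complex_limits.
Context (R : realType) (T : Type) (F : set_system T) (FF : Filter F).
Implicit Types (u : T -> R[i]^o) (l : R[i]^o).

Lemma cvg_complexRe u l : u x @[x --> F] --> l ->
  complex.Re (u x) @[x --> F] --> complex.Re l.
Proof.
move=> /cvgrPdist_lt ul; apply/cvgrPdist_lt => e e0.
have e0' : 0 < (e%:C%C : R[i]) by rewrite ltcR.
apply: filterS (ul _ e0') => x /=; rewrite -ltcR; apply: le_lt_trans.
by rewrite -raddfB lecR; exact: Re_le_cmod.
Qed.

Lemma cvg_complexIm u l : u x @[x --> F] --> l ->
  complex.Im (u x) @[x --> F] --> complex.Im l.
Proof.
move=> /cvgrPdist_lt ul; apply/cvgrPdist_lt => e e0.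
have e0' : 0 < (e%:C%C : R[i]) by rewrite ltcR.
apply: filterS (ul _ e0') => x /=; rewrite -ltcR; apply: le_lt_trans.
by rewrite -raddfB lecR; exact: Im_le_cmod.
Qed.

Lemma cvg_real_complex (u : T -> R) (l : R) : u x @[x --> F] --> l ->
  ((u x)%:C%C : R[i]^o) @[x --> F] --> (l%:C%C : R[i]^o).
Proof.
(* The radius ranges over [R[i]]; its positivity forces the imaginary part [e'] to be 0. *)
move=> /cvgrPdist_lt ul; apply/cvgrPdist_lt => -[e e'] /=.
rewrite ltcE /= => /andP[/eqP -> e0].
apply: filterS (ul _ e0) => x /=; rewrite -ltcR; apply: le_lt_trans.
by rewrite -raddfB normc_def /= expr0n addr0 sqrtr_sqr.
Qed.

End complex_limits.

(* Stating the algebra of limits over an abstract field keeps unification from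
   unfolding the field structure of [R[i]]. *)
Section field_limits.
Context (K : numFieldType) (T : Type) (F : set_system T) (FF : Filter F).
Implicit Types (u v : T -> K^o) (l m : K).

Lemma field_cvgD u v l m :
  u x @[x --> F] --> (l : K^o) -> v x @[x --> F] --> (m : K^o) ->
  ((u x : K) + (v x : K) : K^o) @[x --> F] --> (l + m : K^o).
Proof. exact: cvgD. Qed.

Lemma field_cvgM u v l m :
  u x @[x --> F] --> (l : K^o) -> v x @[x --> F] --> (m : K^o) ->
  ((u x : K) * (v x : K) : K^o) @[x --> F] --> (l * m : K^o).
Proof. exact: cvgM. Qed.

Lemma field_cvgN u l :
  u x @[x --> F] --> (l : K^o) ->
  (- (u x : K) : K^o) @[x --> F] --> (- l : K^o).
Proof. exact: cvgN. Qed.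

End field_limits.

Lemma field_cvg_lim (K : numFieldType) (T : Type) (F : set_system T)
    (FF : ProperFilter F) (u : T -> K^o) (l : K) :
  u x @[x --> F] --> (l : K^o) -> lim (u x @[x --> F]) = (l : K^o).
Proof. by move=> ul; apply: cvg_lim ul; exact: norm_hausdorff. Qed.

Section complex_limits_algebra.
Context (R : realType) (T : Type) (F : set_system T) (FF : Filter F).
Implicit Types (u v : T -> R[i]^o) (l m : R[i]).

Lemma ccvgD u v l m :
  u x @[x --> F] --> (l : R[i]^o) -> v x @[x --> F] --> (m : R[i]^o) ->
  ((u x : R[i]) + (v x : R[i]) : R[i]^o) @[x --> F] --> (l + m : R[i]^o).
Proof. exact: (@field_cvgD R[i] T F FF u v l m). Qed.

Lemma ccvgM u v l m :
  u x @[x --> F] --> (l : R[i]^o) -> v x @[x --> F] --> (m : R[i]^o) ->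
  ((u x : R[i]) * (v x : R[i]) : R[i]^o) @[x --> F] --> (l * m : R[i]^o).
Proof. exact: (@field_cvgM R[i] T F FF u v l m). Qed.

Lemma ccvgN u l : u x @[x --> F] --> (l : R[i]^o) ->
  (- (u x : R[i]) : R[i]^o) @[x --> F] --> (- l : R[i]^o).
Proof. exact: (@field_cvgN R[i] T F FF u l). Qed.

Lemma ccvg_sum (I : Type) (r : seq I) (v : I -> T -> R[i]^o) (l : I -> R[i]) :
  (forall i, v i x @[x --> F] --> (l i : R[i]^o)) ->
  (\sum_(i <- r) (v i x : R[i]) : R[i]^o) @[x --> F] -->
  (\sum_(i <- r) l i : R[i]^o).
Proof.
move=> vl; elim: r => [|i r IH].
  by rewrite big_nil; apply: cvg_near_cst; apply: nearW => x; rewrite big_nil.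
rewrite big_cons; apply: cvg_trans (ccvgD (vl i) IH).
by apply: near_eq_cvg; apply: nearW => x; rewrite big_cons.
Qed.

End complex_limits_algebra.

(** * Calculus of derivatives relative to a set *)

Section has_cderiv.
Context (R : realType).
Implicit Types (D : set R) (f g : R -> R[i]) (s t : R).

Definition cslope f t s : R[i] := (f s - f t) / (s - t)%:C%C.

(** A relation rather than the total function [cderiv], whose value says nothing when the limit does
    not exist. *)
Definition has_cderiv D f t (d : R[i]) : Prop :=
  (cslope f t s : R[i]^o) @[s --> within D t^'] --> (d : R[i]^o).

Lemma complex_subr_neq0 s t : s != t -> (s - t)%:C%C != 0 :> R[i].
Proof. by move=> st; rewrite eq_complex /= eqxx andbT subr_eq0. Qed.

Lemma near_within_dnbhs_neq D t : \forall s \near within D t^', s != t.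
Proof. exact: (cvg_within D (nbhs_dnbhs_neq t)). Qed.

Lemma dnbhs_within_setT t : t^' = within setT t^'.
Proof.
apply/seteqP; split => A hA.
- by change (t^' (fun s => setT s -> A s)); apply: filterS hA.
- by apply: (filterS _ (hA : t^' (fun s => setT s -> A s))) => s; exact.
Qed.

Lemma within_dnbhsW D t : within D t^' `=>` within D (nbhs t).
Proof. by move=> A; exact: nbhs_dnbhs. Qed.

Lemma has_cderiv_id D t : has_cderiv D (fun s => s%:C%C) t 1.
Proof.
apply: cvg_near_cst; near=> s.
rewrite /cslope -raddfB divff// complex_subr_neq0//.
by near: s; exact: near_within_dnbhs_neq.
Unshelve. all: by end_near. Qed.

Lemma has_cderiv_cst D t c : has_cderiv D (fun=> c) t 0.
Proof.
apply: cvg_near_cst; apply: nearW => s.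
by rewrite /cslope subrr mul0r.
Qed.

Lemma has_cderivD D f g t df dg : has_cderiv D f t df -> has_cderiv D g t dg ->
  has_cderiv D (fun s => f s + g s) t (df + dg).
Proof.
move=> hf hg; rewrite /has_cderiv.
have -> : cslope (fun s => f s + g s) t =
    (fun s => cslope f t s + cslope g t s).
  by apply/funext => s; rewrite /cslope opprD addrACA mulrDl.
exact: (ccvgD _ hf hg).
Qed.

Lemma has_cderiv_continuous D f t d : has_cderiv D f t d ->
  (f s : R[i]^o) @[s --> within D (nbhs t)] --> (f t : R[i]^o).
Proof.
move=> hf.
have h : (f s : R[i]^o) @[s --> within D t^'] --> (f t : R[i]^o).
  have st : ((s%:C%C : R[i]^o) - t%:C%C) @[s --> within D t^'] --> (0 : R[i]^o).
    rewrite -(subrr (t%:C%C : R[i])).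
    apply: ccvgD; last exact: cvg_cst.
    apply: cvg_real_complex; apply: cvg_within_filter.
    exact: nbhs_dnbhs.
  have /(_ _ _ _) := ccvgD _ (ccvgM _ hf st) (cvg_cst (f t : R[i]^o)).
  rewrite mulr0 add0r; apply: cvg_trans; apply: near_eq_cvg; near=> s.
  rewrite /cslope /= -raddfB divfK ?subrK// complex_subr_neq0//.
  by near: s; exact: near_within_dnbhs_neq.
apply/cvg_ballP => e e0; move/cvg_ballP: h => /(_ e e0).
rewrite !near_withinE => h; near=> s => Ds.
have [->|st] := eqVneq s t; first exact: ballxx.
by move: st Ds; near: s; exact: h.
Unshelve. all: by end_near. Qed.

Lemma has_cderivM D f g t df dg : has_cderiv D f t df -> has_cderiv D g t dg ->
  has_cderiv D (fun s => f s * g s) t (df * g t + f t * dg).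
Proof.
move=> hf hg; rewrite /has_cderiv.
have -> : cslope (fun s => f s * g s) t =
    (fun s => cslope f t s * g s + f t * cslope g t s).
  by apply/funext => s; rewrite /cslope; ring.
have gt : (g s : R[i]^o) @[s --> within D t^'] --> (g t : R[i]^o).
  apply: cvg_trans (has_cderiv_continuous hg).
  by apply: cvg_app; apply: within_dnbhsW.
exact: (ccvgD _ (ccvgM _ hf gt) (ccvgM _ (cvg_cst (f t : R[i]^o)) hg)).
Qed.

Lemma has_cderiv_eq D f g t d d' : has_cderiv D f t d ->
  f =1 g -> d = d' -> has_cderiv D g t d'.
Proof. by move=> + /funext <- <-. Qed.

Lemma has_cderivZ D c f t d : has_cderiv D f t d ->
  has_cderiv D (fun s => c * f s) t (c * d).
Proof.
move=> hf; have h := has_cderivM (has_cderiv_cst D t c) hf.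
apply: has_cderiv_eq h _ _ => //.
by rewrite mul0r add0r.
Qed.

Lemma has_cderivB D f g t df dg : has_cderiv D f t df -> has_cderiv D g t dg ->
  has_cderiv D (fun s => f s - g s) t (df - dg).
Proof.
move=> hf hg.
have h := has_cderivD hf (@has_cderivZ D (-1) g t dg hg).
by apply: has_cderiv_eq h _ _ => [s|]; rewrite mulN1r.
Qed.

Lemma has_cderiv_sum D t (I : Type) (r : seq I) (P : pred I)
    (f : I -> R -> R[i]) d :
  (forall i, P i -> has_cderiv D (f i) t (d i)) ->
  has_cderiv D (fun s => \sum_(i <- r | P i) f i s) t (\sum_(i <- r | P i) d i).
Proof.
move=> hf; elim: r => [|i r IH].
  rewrite big_nil; apply: has_cderiv_eq (has_cderiv_cst D t 0) _ _ => // s.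
  by rewrite big_nil.
rewrite big_cons; case: ifPn => Pi.
  apply: has_cderiv_eq (has_cderivD (hf _ Pi) IH) _ _ => // s.
  by rewrite big_cons Pi.
apply: has_cderiv_eq IH _ _ => // s.
by rewrite big_cons (negbTE Pi).
Qed.

Lemma has_cderivXn D t n :
  has_cderiv D (fun s => s%:C%C ^+ n) t (n%:R * t%:C%C ^+ n.-1).
Proof.
elim: n => [|n IH].
  by apply: has_cderiv_eq (has_cderiv_cst D t 1) _ _ => //; rewrite mul0r.
apply: has_cderiv_eq (has_cderivM (has_cderiv_id D t) IH) _ _.
  by move=> s; rewrite exprS.
rewrite mul1r; case: n {IH} => [|n] /=.
  by rewrite mul0r mulr0 addr0 mul1r.
by rewrite mulrCA -exprS -{1}[_ ^+ n.+1]mul1r -mulrDl -(nat1r n.+1).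
Qed.

Lemma has_cderiv_within D f t d : has_cderiv setT f t d -> has_cderiv D f t d.
Proof.
by apply: cvg_trans; apply: cvg_app; apply: within_subset.
Qed.

(** The function [f] is differentiated on the whole line because [x - s] leaves [D]; injectivity of
    [s |-> x - s] keeps punctured neighbourhoods punctured. *)
Lemma has_cderiv_reflect D f (x : R) t d :
  has_cderiv setT f (x - t) d -> has_cderiv D (fun s => f (x - s)) t (- d).
Proof.
move=> hf; apply: has_cderiv_within; rewrite /has_cderiv.
have -> : cslope (fun s => f (x - s)) t =
    (fun s => - cslope f (x - t) (x - s)).
  apply/funext => s; rewrite /cslope.
  have -> : x - s - (x - t) = - (s - t) by ring.
  by rewrite raddfN invrN mulrN opprK.
apply: ccvgN.
apply: (@cvg_comp _ _ _ (fun s => x - s)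
  (fun s => cslope f (x - t) s : R[i]^o) _ _ _ _ hf).
rewrite -!dnbhs_within_setT.
apply: continuous_injective_withinNx.
  by apply: cvgB; [exact: cvg_cst|exact: cvg_id].
by move=> y /addrI /oppr_inj.
Qed.

(** Caratheodory's criterion: the quotient, extended by [d] at [t], is the continuous factor of
    [f s - f t]. *)
Lemma is_derive_slope (f : R -> R) t d :
  is_derive t 1 f d <-> (f s - f t) / (s - t) @[s --> t^'] --> d.
Proof.
rewrite is_derive1_caratheodory; split=> [[g [fE gc <-]]|h].
  move/continuous_withinNx: gc; apply: cvg_trans; apply: near_eq_cvg; near=> s.
  rewrite /= fE mulfK// subr_eq0.
  by near: s; exact: nbhs_dnbhs_neq.
exists (fun s => if s == t then d else (f s - f t) / (s - t)); split.
- move=> s; case: eqVneq => [->|st]; first by rewrite !subrr mulr0.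
  by rewrite divfK// subr_eq0.
- apply/continuous_withinNx; rewrite eqxx.
  apply: cvg_trans h; apply: near_eq_cvg; near=> s.
  rewrite ifN//.
  by near: s; exact: nbhs_dnbhs_neq.
- by rewrite eqxx.
Unshelve. all: by end_near. Qed.

Lemma has_cderiv_real D (f : R -> R) t d : is_derive t 1 f d ->
  has_cderiv D (fun s => (f s)%:C%C) t d%:C%C.
Proof.
move=> /is_derive_slope hf; apply: has_cderiv_within; rewrite /has_cderiv.
have -> : cslope (fun s => (f s)%:C%C) t =
    (fun s => ((f s - f t) / (s - t))%:C%C).
  by apply/funext => s; rewrite /cslope rmorphM fmorphV !rmorphB.
by apply: cvg_real_complex; rewrite -dnbhs_within_setT.
Qed.

(** Real derivatives are two-sided, so [D] has to be a neighbourhood of [t]. *)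
Lemma has_cderiv_is_derive D (f : R -> R[i]) t d :
  (\forall s \near t, D s) -> has_cderiv D f t d ->
  is_derive t 1 (fun s => complex.Re (f s)) (complex.Re d) /\
  is_derive t 1 (fun s => complex.Im (f s)) (complex.Im d).
Proof.
move=> Dt hf.
have {}hf : (cslope f t s : R[i]^o) @[s --> t^'] --> (d : R[i]^o).
  apply: cvg_trans hf; apply: cvg_app => A hA.
  have {}Dt : \forall s \near t^', D s by exact: nbhs_dnbhs.
  by apply: filterS2 Dt hA => s Ds; exact.
split; apply/is_derive_slope.
  apply: cvg_trans (cvg_complexRe _ hf); apply: near_eq_cvg; apply: nearW => s.
  by rewrite /cslope Re_scale raddfB.
apply: cvg_trans (cvg_complexIm _ hf); apply: near_eq_cvg; apply: nearW => s.
by rewrite /cslope Im_scale raddfB.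
Qed.

Lemma has_cderiv_cexp D (l : R[i]) t :
  has_cderiv D (fun s => cexp (l * s%:C%C)) t (l * cexp (l * t%:C%C)).
Proof.
case: l => u v.
have lin w : is_derive t 1 (fun s => w * s) w.
  by rewrite -[X in is_derive _ _ _ X]mulr1; exact: is_deriveZ.
have hexp : is_derive t 1 (fun s => expR (u * s)) (expR (u * t) * u).
  exact: (is_derive1_comp (f := expR)).
have hcos : is_derive t 1 (fun s => cos (v * s)) (- sin (v * t) * v).
  exact: (is_derive1_comp (f := cos)).
have hsin : is_derive t 1 (fun s => sin (v * s)) (cos (v * t) * v).
  exact: (is_derive1_comp (f := sin)).
have := has_cderivM (has_cderiv_real D hexp)
  (has_cderivD (has_cderiv_real D hcos)
    (@has_cderivZ D (Complex 0 1) _ _ _ (has_cderiv_real D hsin))).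
move=> h; apply: has_cderiv_eq h _ _ => [s|]; rewrite /cexp /=.
  by apply/eqP; rewrite eq_complex /=; apply/andP; split; apply/eqP;
     rewrite ?(mul0r, mulr0, subr0, addr0, add0r, mul1r).
rewrite !mulr0 subr0 add0r.
apply/eqP; rewrite eq_complex /=; apply/andP; split; apply/eqP; ring.
Qed.

Lemma cderivableP D f t : cderivable D f t -> has_cderiv D f t (cderiv D f t).
Proof. by []. Qed.

Lemma has_cderiv_cderiv f t d : has_cderiv setT f t d -> cderiv setT f t = d.
Proof.
move=> hf.
apply: (@field_cvg_lim R[i] _ _ _ (cslope f t) d) => //.
rewrite -dnbhs_within_setT; exact: Proper_dnbhs_numFieldType.
Qed.

End has_cderiv.

(** * The exponential series *)

Section complex_exponential_series.
Context (R : realType).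
Implicit Types (z l : R[i]).

(** Differentiation lowers the order of a tail by one, and order 0 is the exponential itself, which
    is stationary; hence the [r.-1] in its derivative. *)
Definition cexp_tail (r : nat) z : R[i] :=
  cexp z - \sum_(p < r) z ^+ p / p`!%:R.

Lemma cexp0 : cexp (0 : R[i]) = 1.
Proof. by rewrite /cexp /= expR0 cos0 sin0 mulr1 mulr0. Qed.

Lemma cexpD z w : cexp (z + w) = cexp z * cexp w.
Proof.
case: z w => [x y] [u v]; rewrite /cexp /= expRD cosD sinD.
by apply/eqP; rewrite eq_complex /=; apply/andP; split; apply/eqP; ring.
Qed.

Lemma cexpX z n : cexp z ^+ n = cexp (n%:R * z).
Proof.
elim: n => [|n IH]; first by rewrite mul0r cexp0.
by rewrite exprS IH -cexpD -nat1r mulrDl mul1r.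
Qed.

Lemma cexp_tail0 r : (0 < r)%N -> cexp_tail r 0 = 0.
Proof.
case: r => // r _; rewrite /cexp_tail cexp0 big_ord_recl /= big1 ?addr0.
  by rewrite divr1 subrr.
by move=> i _; rewrite exprS !mul0r.
Qed.

Lemma has_cderiv_cexp_tail D l r t :
  has_cderiv D (fun s => cexp_tail r (l * s%:C%C)) t
    (l * cexp_tail r.-1 (l * t%:C%C)).
Proof.
rewrite /cexp_tail mulrBr; apply: has_cderivB; first exact: has_cderiv_cexp.
case: r => [|r].
  rewrite big_ord0 mulr0.
  apply: has_cderiv_eq (@has_cderiv_cst R D t 0) _ _ => // s.
  by rewrite big_ord0.
have h (i : 'I_r.+1) : has_cderiv D (fun s => (l * s%:C%C) ^+ i / i`!%:R) t
    (l ^+ i / i`!%:R * (i%:R * t%:C%C ^+ i.-1)).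
  have h := @has_cderivZ R D (l ^+ i / i`!%:R) _ _ _ (@has_cderivXn R D t i).
  apply: has_cderiv_eq h _ _ => // s.
  by rewrite exprMn mulrAC.
have := @has_cderiv_sum R D t _ (index_enum _) predT _ _ (fun i _ => h i).
move=> {}h; apply: has_cderiv_eq h _ _ => //.
rewrite big_ord_recl /= mul0r mulr0 add0r big_distrr; apply: eq_bigr => i _ /=.
rewrite /bump /= add1n factS natrM exprS exprMn invfM.
have a0 : i.+1%:R != 0 :> R[i] by rewrite pnatr_eq0.
move: (i.+1%:R) a0 => a a0.
have -> : l * l ^+ i * (a^-1 * i`!%:R^-1) * (a * t%:C%C ^+ i) =
  (a^-1 * a) * (l * (l ^+ i * t%:C%C ^+ i / i`!%:R)) by ring.
by rewrite mulVf// mul1r.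
Qed.

(** The mean value theorem, applied to [g - f] and [g + f], whose derivatives are nonnegative on
    [[0, s]]. *)
Lemma real_increment_le (f df : R -> R) (g dg : R -> R) (s : R) :
  0 <= s ->
  (forall x : R, is_derive x 1 f (df x)) ->
  (forall x : R, is_derive x 1 g (dg x)) ->
  (forall x, 0 <= x <= s -> `|df x| <= dg x) ->
  `|f s - f 0| <= g s - g 0.
Proof.
move=> s0 hf hg le.
have cont (h dh : R -> R) : (forall x : R, is_derive x 1 h (dh x)) ->
    {within `[0, s], continuous h}.
  move=> hh; apply: continuous_subspaceT => x.
  have dx : derivable h x 1 by case: (hh x).
  exact/differentiable_continuous/derivable1_diffP.
have key (h dh : R -> R) : (forall x : R, is_derive x 1 h (dh x)) ->
    (forall x, 0 <= x <= s -> dh x <= dg x) -> h s - h 0 <= g s - g 0.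
  move=> hh hle.
  have hd (x : R) : is_derive x 1 (fun y => g y - h y) (dg x - dh x).
    exact: is_deriveB.
  have [c] := @MVT_segment R _ _ 0 s s0 (fun x _ => hd x) (cont _ _ hd).
  rewrite in_itv /= => /hle cle e.
  have : 0 <= g s - h s - (g 0 - h 0) by rewrite e mulr_ge0// subr_ge0.
  by lra.
rewrite ler_norml; apply/andP; split; last first.
  by apply: key hf _ => x /le; rewrite ler_norml => /andP[].
have hN (x : R) : is_derive x 1 (fun y => - f y) (- df x) by exact: is_deriveN.
have := key _ _ hN; rewrite lerNl opprB => h.
have := h _; rewrite opprK addrC; apply => x /le; rewrite ler_norml => /andP[].
by rewrite lerNl.
Qed.

(* Induction on [r]: the derivative of the tail of order [r + 1] is, up to the
   factor [l], the tail of order [r]. The factor [2] in [2 * cnorm1 l] pays for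
   bounding the real and imaginary parts separately. *)
Lemma cexp_tail_le l (M : R) r s :
  (forall x, 0 <= x <= 1 -> cnorm1 (cexp (l * x%:C%C)) <= M) ->
  0 <= s <= 1 ->
  cnorm1 (cexp_tail r (l * s%:C%C)) <=
    M * ((2 * cnorm1 l * s) ^+ r / r`!%:R).
Proof.
move=> hM; elim: r s => [|r IH] s s01.
  by rewrite /cexp_tail big_ord0 subr0 expr0 divr1 mulr1 hM.
set C := 2 * cnorm1 l.
have dh (x : R) := @has_cderiv_is_derive R setT _ _ _
  (@filterT _ (nbhs x) (nbhs_filter x)) (@has_cderiv_cexp_tail setT l r.+1 x).
pose g x : R := M / 2 * (C ^+ r.+1 / r.+1`!%:R) * x ^+ r.+1.
pose dg x : R := M / 2 * (C ^+ r.+1 / r.+1`!%:R) * (r.+1%:R * x ^+ r).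
have hg (x : R) : is_derive x 1 g (dg x).
  apply: is_deriveZ.
  have := @is_deriveX R R id r.+1 x 1 1 (is_derive_id x 1).
  by rewrite exprfctE /= -[_ *: 1]/(_ * 1) mulr1.
have gle x : 0 <= x <= s -> cnorm1 (l * cexp_tail r (l * x%:C%C)) <= dg x.
  move=> /andP[x0 xs].
  apply: le_trans (cnorm1M _ _) _.
  have x01 : 0 <= x <= 1 by case/andP: s01 => _ ?; rewrite x0 (le_trans xs).
  have n0 : 0 <= cnorm1 l by rewrite addr_ge0.
  apply: le_trans (ler_wpM2l n0 (IH _ x01)) _.
  rewrite /dg -/C exprMn [C ^+ r.+1]exprS factS natrM invfM.
  have a0 : r.+1%:R != 0 :> R by rewrite pnatr_eq0.
  have -> : M / 2 * (C * C ^+ r * (r.+1%:R^-1 * r`!%:R^-1)) *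
      (r.+1%:R * x ^+ r) =
    (r.+1%:R^-1 * r.+1%:R) * (M / 2 * C * (C ^+ r * x ^+ r / r`!%:R)) by ring.
  rewrite mulVf// mul1r /C.
  have -> : M / 2 * (2 * cnorm1 l) = cnorm1 l * M by field.
  by rewrite [leLHS]mulrA.
have g0 : g 0 = 0 by rewrite /g expr0n mulr0.
have s0 : 0 <= s by case/andP: s01.
have t0 : cexp_tail r.+1 (l * (0 : R)%:C%C) = 0 by rewrite mulr0 cexp_tail0.
have hRe := @real_increment_le _ _ g dg s s0 (fun x => (dh x).1) hg _.
have hIm := @real_increment_le _ _ g dg s s0 (fun x => (dh x).2) hg _.
rewrite t0 g0 !subr0 /= in hRe hIm.
rewrite exprMn; have -> : M * (C ^+ r.+1 * s ^+ r.+1 / r.+1`!%:R) = g s + g s.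
  by rewrite /g; field; rewrite pnatr_eq0 -lt0n fact_gt0.
rewrite /cnorm1 lerD//.
- apply: hRe => x /gle; apply: le_trans; by rewrite /cnorm1 lerDl.
- apply: hIm => x /gle; apply: le_trans; by rewrite /cnorm1 lerDr.
Qed.

Lemma cnorm1_cexp_le l x : 0 <= x <= 1 ->
  cnorm1 (cexp (l * x%:C%C)) <= 2 * expR `|complex.Re l|.
Proof.
move=> /andP[x0 x1]; case: l => u v; rewrite /cnorm1 /= !mulr0 subr0 add0r.
have e : expR (u * x) <= expR `|u|.
  rewrite ler_expR; apply: le_trans (ler_norm _) _.
  by rewrite normrM (ger0_norm x0) ler_piMr.
have c : `|expR (u * x) * cos (v * x)| <= expR `|u|.
  rewrite normrM (ger0_norm (expR_ge0 _)); apply: le_trans e.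
  by rewrite ler_piMr ?expR_ge0// ler_norml cos_geN1 cos_le1.
have s : `|expR (u * x) * sin (v * x)| <= expR `|u|.
  rewrite normrM (ger0_norm (expR_ge0 _)); apply: le_trans e.
  by rewrite ler_piMr ?expR_ge0// ler_norml sin_geN1 sin_le1.
lra.
Qed.

Lemma cvg_cnorm1 (u : nat -> R[i]) (v : nat -> R) :
  (forall n, cnorm1 (u n) <= v n) -> v n @[n --> \oo] --> 0 ->
  (u n : R[i]^o) @[n --> \oo] --> (0 : R[i]^o).
Proof.
move=> uv v0.
have vge n : 0 <= v n by apply: le_trans (uv n); rewrite addr_ge0.
apply/cvgrPdist_lt => -[e e'] /=.
rewrite ltcE /= => /andP[/eqP -> e0].
have {}v0 : \forall n \near \oo, `|0 - v n| < e by move/cvgrPdist_lt: v0; exact.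
apply: filterS v0 => n; rewrite !sub0r !normrN => vn.
suff : cmod (u n) < e by rewrite -ltcR.
apply: le_lt_trans vn; rewrite ger0_norm//.
exact: le_trans (cmod_le_cnorm1 _) (uv n).
Qed.

Lemma cvg_cexp_tail z :
  (cexp_tail r z : R[i]^o) @[r --> \oo] --> (0 : R[i]^o).
Proof.
pose C : R := 2 * cnorm1 z; pose M : R := 2 * expR `|complex.Re z|.
apply: (@cvg_cnorm1 _ (fun r => M * exp_coeff C r)).
  (* The estimate is taken at the endpoint [s = 1], with [z] as the coefficient. *)
  move=> r; have := @cexp_tail_le z M r 1 (cnorm1_cexp_le z).
  by rewrite !mulr1 lexx ler01; apply.
rewrite -(mulr0 M); apply: cvgM; first exact: cvg_cst.
exact: cvg_exp_coeff.
Qed.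

End complex_exponential_series.

(** * The derivatives of [zeta] *)

Section power_sums.
Context (R : realType).

Lemma cexp_2pi_i : cexp (Complex 0 (2 * pi)) = 1 :> R[i].
Proof. by rewrite /cexp /= expR0 mulr_natl cos2pi sin2pi !mul1r. Qed.

Lemma complexM_i (x y : R) : x%:C%C * Complex 0 y = Complex 0 (x * y) :> R[i].
Proof.
by apply/eqP; rewrite eq_complex /=; apply/andP; split; apply/eqP; ring.
Qed.

Lemma natr_complex (n : nat) : n%:R = (n%:R)%:C%C :> R[i].
Proof. by rewrite rmorph_nat. Qed.

(** The real part is [1 - 2 * sin (t / 2) ^+ 2], which is below 1 because [t / 2] lies strictly
    between 0 and [pi]. *)
Lemma cexp_angle_neq1 (t : R) :
  0 < t < 2 * pi -> cexp (Complex 0 t) != 1 :> R[i].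
Proof.
move=> /andP[t0 t2]; apply/eqP => /(congr1 (@complex.Re R)).
rewrite /cexp /= expR0 mul1r => c1.
have : sin (t / 2) > 0.
  by apply: sin_gt0_pi; rewrite divr_gt0//= ltr_pdivrMr// mulrC.
have t2E : t = (t / 2) *+ 2 by rewrite -mulr_natr divfK.
move: c1; rewrite [in cos t]t2E cos_mulr2n => c1 s0.
have := cos2Dsin2 (t / 2).
have : 0 < sin (t / 2) ^+ 2 by rewrite exprn_gt0.
move: c1; rewrite -mulr_natr; lra.
Qed.

Context (m : nat) (m_gt0 : (0 < m)%N).

Definition unity : R[i] := cexp (Complex 0 (2 * pi / m%:R)).

Let m_neq0 : m%:R != 0 :> R.
Proof. by rewrite pnatr_eq0 -lt0n. Qed.

Lemma unityX q : unity ^+ q = cexp (Complex 0 (2 * q%:R * pi / m%:R)).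
Proof.
rewrite /unity cexpX natr_complex complexM_i; congr (cexp (Complex 0 _)).
by rewrite mulrA mulrCA mulrA.
Qed.

Lemma unity_expm : unity ^+ m = 1.
Proof.
rewrite unityX -[RHS]cexp_2pi_i; congr (cexp (Complex 0 _)).
by rewrite [_ * m%:R * _]mulrAC mulfK// m_neq0.
Qed.

Lemma unityX_neq1 q : ~~ (m %| q)%N -> unity ^+ q != 1.
Proof.
rewrite /dvdn -lt0n => qm.
rewrite (divn_eq q m) exprD mulnC exprM unity_expm expr1n mul1r unityX.
apply: cexp_angle_neq1.
have p0 := @pi_gt0 R; have m0 : 0 < m%:R :> R by rewrite ltr0n.
rewrite divr_gt0 ?mulr_gt0 ?ltr0n//= ltr_pdivrMr// mulrAC ltr_pM2l ?mulr_gt0//.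
rewrite ltr_nat.
by rewrite ltn_pmod.
Qed.

Lemma geometric_unity_sum (x : R[i]) : x != 1 -> x ^+ m = 1 ->
  \sum_(l < m) x ^+ l = 0.
Proof.
move=> x1 xm; have := subrX1 x m; rewrite xm subrr => /esym/eqP.
by rewrite mulf_eq0 subr_eq0 (negbTE x1) /= => /eqP.
Qed.

Context (gamma : R[i]).

(** For [m = n - k] these are roots of [X^n - gamma X^k], the characteristic polynomial of the
    operator, indexed as in the hypotheses on the exponentials. *)
Definition char_root (l : nat) : R[i] := m.-root gamma * unity ^+ l.

Lemma char_root_expm l : char_root l ^+ m = gamma.
Proof.
by rewrite exprMn rootCK// -exprM mulnC exprM unity_expm expr1n mulr1.
Qed.

Lemma sum_char_root_dvd q :
  \sum_(l < m) char_root l ^+ (q * m) = m%:R * gamma ^+ q.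
Proof.
under eq_bigr do rewrite mulnC exprM char_root_expm.
by rewrite sumr_const card_ord mulr_natl.
Qed.

Lemma sum_char_root_ndvd q : ~~ (m %| q)%N ->
  \sum_(l < m) char_root l ^+ q = 0.
Proof.
move=> mq; rewrite -[RHS](mulr0 (m.-root gamma ^+ q)).
have e : \sum_(l < m) (unity ^+ q) ^+ l = 0.
  apply: geometric_unity_sum; first exact: unityX_neq1.
  by rewrite -exprM mulnC exprM unity_expm expr1n.
rewrite -[X in _ = _ * X]e big_distrr; apply: eq_bigr => l _ /=.
by rewrite exprMn -!exprM mulnC.
Qed.

(** Negative powers come from the Taylor terms removed in [exp_kernel], which carry
    [lam l ^ (j + p - n)] with [j + p < n]. *)
Lemma sum_char_rootV_ndvd q : ~~ (m %| q)%N ->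
  \sum_(l < m) (char_root l ^+ q)^-1 = 0.
Proof.
move=> mq; rewrite -[RHS](mulr0 ((m.-root gamma ^+ q)^-1%R)).
have e : \sum_(l < m) ((unity ^+ q)^-1%R) ^+ l = 0.
  apply: geometric_unity_sum; first by rewrite invr_eq1; exact: unityX_neq1.
  by rewrite exprVn -exprM mulnC exprM unity_expm expr1n invr1.
rewrite -[X in _ = _ * X]e big_distrr; apply: eq_bigr => l _ /=.
by rewrite exprMn -exprM mulnC exprM invfM exprVn.
Qed.

End power_sums.

(** * The Green function and its derivatives as averages of exponential tails *)

Section kernel_family.
Context (R : realType) (n k : nat) (kn : (k < n)%N) (gamma : R[i]).
Local Notation m := (n - k)%N.
Local Notation lam := (char_root m gamma).

Let m_gt0 : (0 < m)%N. Proof. by rewrite subn_gt0. Qed.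
Let mC_neq0 : m%:R != 0 :> R[i]. Proof. by rewrite pnatr_eq0 -lt0n. Qed.

(* Summing [lam l ^ (p - n) * s ^ p / p!] over the [m]-th roots [lam l] of
   [gamma] selects the [p] congruent to [n] modulo [m]; dropping the terms
   [p < n] leaves the series of [zeta], whose [j]-th derivative follows. *)
Definition exp_kernel (j : nat) (s : R) : R[i] :=
  m%:R^-1 *
  \sum_(l < m) lam l ^+ j / lam l ^+ n * cexp_tail (n - j) (lam l * s%:C%C).

(** Each differentiation brings down a factor [lam l] and lowers the order of the tail; for [j >= n]
    the truncated subtraction keeps the order at 0, where only exponentials remain. *)
Lemma has_cderiv_exp_kernel j s :
  has_cderiv setT (exp_kernel j) s (exp_kernel j.+1 s).
Proof.
apply: has_cderivZ.
have := @has_cderiv_sum R setT s _ (index_enum 'I_m) predT _ _ (fun l _ =>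
  @has_cderivZ R setT (lam l ^+ j / lam l ^+ n) _ _ _
    (@has_cderiv_cexp_tail R setT (lam l) (n - j) s)).
move=> h; apply: has_cderiv_eq h _ _ => //.
apply: eq_bigr => l _; rewrite subnS mulrA; congr (_ * _).
by rewrite exprSr mulrAC.
Qed.

Hypothesis gamma0 : gamma != 0.

Let lam_neq0 l : lam l != 0.
Proof.
apply/eqP => l0; have := char_root_expm m_gt0 gamma l.
by rewrite l0 expr0n (gtn_eqF m_gt0) => /esym/eqP; rewrite (negbTE gamma0).
Qed.

Lemma exp_kernel_at0 j : (j <= n)%N -> exp_kernel j 0 = (j == n)%:R.
Proof.
rewrite leq_eqVlt => /predU1P[->|jn]; last first.
  rewrite (ltn_eqF jn) /exp_kernel big1 ?mulr0// => l _.
  by rewrite mulr0 cexp_tail0 ?mulr0// subn_gt0.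
rewrite eqxx /exp_kernel; under eq_bigr => l _.
  rewrite subnn mulr0 /cexp_tail big_ord0 subr0 cexp0 mulr1 mulfV ?expf_neq0//.
  over.
by rewrite sumr_const card_ord mulVf.
Qed.

(** Since [lam l ^+ m = gamma], both sides carry the coefficient [lam l], on the full exponential on
    the left and on the tail of order [m.-1] on the right. The Taylor terms missing on the right
    involve power sums of exponents 1 to [m - 1], which vanish. *)
Lemma exp_kernel_ode s : exp_kernel n.+1 s = gamma * exp_kernel k.+1 s.
Proof.
rewrite /exp_kernel mulrCA; congr (_ * _).
rewrite subnS subnn /= subnS.
transitivity (\sum_(l < m) lam l * cexp_tail m.-1 (lam l * s%:C%C)); last first.
  rewrite big_distrr; apply: eq_bigr => l _ /=; rewrite mulrA; congr (_ * _).
  rewrite -[X in X * (_ / _)](char_root_expm m_gt0 gamma l) mulrA -exprD.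
  rewrite addnS subnK 1?ltnW//.
  by rewrite exprS mulfK// expf_neq0.
apply/eqP; rewrite -subr_eq0 -sumrB; apply/eqP.
transitivity (\sum_(l < m) \sum_(p < m.-1)
    s%:C%C ^+ p / p`!%:R * lam l ^+ p.+1).
  apply: eq_bigr => l _; rewrite exprS mulfK ?expf_neq0// -mulrBr.
  rewrite /cexp_tail big_ord0 subr0 subKr big_distrr; apply: eq_bigr => p _ /=.
  by rewrite exprMn exprS; ring.
rewrite exchange_big big1 //= => p _; rewrite -big_distrr /=.
rewrite sum_char_root_ndvd ?mulr0// gtnNdvd// -ltn_predRL.
exact: ltn_ord.
Qed.

Lemma sum_ord_truncate (F : nat -> R[i]) (N K : nat) :
  (forall p, (K <= p < N)%N -> F p = 0) ->
  \sum_(p < N) F p = \sum_(p < K) (if (p < N)%N then F p else 0).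
Proof.
move=> F0; rewrite (big_ord_widen (N + K)%N) ?leq_addr//.
rewrite (big_ord_widen (N + K)%N (fun p => if (p < N)%N then F p else 0))
  ?leq_addl//.
rewrite big_mkcond [RHS]big_mkcond; apply: eq_bigr => p _ /=.
case: ltnP => pN; case: ltnP => pK //.
by rewrite F0// pK.
Qed.

(** Expanding the tails leaves, in degree [p < n - j], the power sum of exponent [- (n - j - p)].
    For [p >= k] this exponent lies strictly between [- m] and 0 because [j > 0], so the sum
    vanishes; for [j = 0] the degree [p = k] would survive. *)
Lemma exp_kernel_span j : (0 < j <= n)%N -> exists c d : nat -> R[i],
  forall s, exp_kernel j s =
    \sum_(l < m) c l * cexp (lam l * s%:C%C) + \sum_(p < k) d p * s%:C%C ^+ p.
Proof.
move=> /andP[j0 jn].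
exists (fun l => m%:R^-1 * (lam l ^+ j / lam l ^+ n)).
exists (fun p => if (p < n - j)%N then
  - (m%:R^-1 / p`!%:R) * \sum_(l < m) (lam l ^+ (n - j - p))^-1 else 0).
move=> s.
pose F p := - (m%:R^-1 / p`!%:R) *
  (\sum_(l < m) (lam l ^+ (n - j - p))^-1) * s%:C%C ^+ p.
transitivity (\sum_(l < m) m%:R^-1 * (lam l ^+ j / lam l ^+ n) *
    cexp (lam l * s%:C%C) + \sum_(p < n - j) F p); last first.
  rewrite (@sum_ord_truncate F _ k).
    by congr (_ + _); apply: eq_bigr => p _; case: ifP => //; rewrite mul0r.
  move=> p /andP[kp pn]; rewrite /F sum_char_rootV_ndvd ?mulr0 ?mul0r//.
  rewrite gtnNdvd ?subn_gt0//.
  rewrite -subnDA ltn_sub2l// (leq_ltn_trans kp)//.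
  by rewrite -[X in (X < _)%N]add0n ltn_add2r.
rewrite /exp_kernel big_distrr /=.
under eq_bigr do rewrite /cexp_tail !mulrBr mulrA.
rewrite sumrB; congr (_ + _).
rewrite -sumrN.
transitivity (\sum_(l < m) \sum_(p < n - j)
   (- (m%:R^-1 / p`!%:R) * s%:C%C ^+ p * (lam l ^+ (n - j - p))^-1)).
  apply: eq_bigr => l _; rewrite !big_distrr -sumrN; apply: eq_bigr => p _ /=.
  have -> : (lam l ^+ (n - j - p))^-1%R =
      lam l ^+ p * (lam l ^+ j / lam l ^+ n).
    have -> : lam l ^+ n = lam l ^+ (n - j - p) * lam l ^+ p * lam l ^+ j.
      by rewrite -!exprD subnK ?(ltnW (ltn_ord p))// subnK.
    have := expf_neq0 j (lam_neq0 l); have := expf_neq0 p (lam_neq0 l).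
    have := expf_neq0 (n - j - p)%N (lam_neq0 l).
    move: (lam l ^+ (n - j - p)) (lam l ^+ p) (lam l ^+ j) => x y z x0 y0 z0.
    rewrite -mulrA invfM mulrCA mulrA [y * z]mulrC mulrCA mulfV ?mulr1//.
    by rewrite mulf_neq0.
  rewrite [(_ * s%:C%C) ^+ _]exprMn.
  move: (lam l ^+ j / lam l ^+ n) (lam l ^+ p) => A B.
  by move: (m%:R^-1%R : R[i]) (p`!%:R^-1%R : R[i]) => A' B'; ring.
rewrite exchange_big; apply: eq_bigr => p _ /=.
by rewrite -big_distrr /= /F mulrAC.
Qed.

Lemma sum_ord_multiples (G : nat -> R[i]) (N : nat) :
  (forall q, ~~ (m %| q)%N -> G q = 0) ->
  \sum_(q < N * m) G q = \sum_(i < N) G (i * m)%N.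
Proof.
move=> G0; elim: N => [|N IH]; first by rewrite mul0n !big_ord0.
rewrite big_ord_recr /= -IH mulSnr -(big_mkord predT) /=.
rewrite (big_cat_nat (leq0n _) (leq_addr _ _)) /= big_mkord; congr (_ + _).
rewrite -{1}[(N * m)%N]add0n [(_ + m)%N]addnC big_addn addnK big_ltn// add0n.
rewrite big_nat_cond big1 ?addr0// => q /andP[/andP[q0 qm] _].
by rewrite G0// dvdn_addl ?dvdn_mull// gtnNdvd.
Qed.

Lemma exp_kernel_zeta s : zeta n k gamma s = exp_kernel 0 s.
Proof.
apply: (@field_cvg_lim R[i]).
(* The remainder after [N] terms: averaging keeps, among the powers from [n] to [n + N * m - 1],
   exactly the first [N] terms of the series, so that these are the difference of the averaged tails
   of orders [n] and [n + N * m]. *)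
pose T N : R[i] := m%:R^-1 *
  \sum_(l < m) (lam l ^+ n)^-1 * cexp_tail (n + N * m) (lam l * s%:C%C).
have T0 : (T N : R[i]^o) @[N --> \oo] --> (0 : R[i]^o).
  rewrite -(mulr0 (m%:R^-1%R)); apply: ccvgM; first exact: cvg_cst.
  rewrite -[X in _ --> X](_ : \sum_(l < m) (lam l ^+ n)^-1%R * 0 = 0);
      last first.
    by rewrite big1// => l _; rewrite mulr0.
  apply: ccvg_sum => l; apply: ccvgM; first exact: cvg_cst.
  apply: (@cvg_comp _ _ _ (fun N => n + N * m)%N
    (fun r => cexp_tail r (lam l * s%:C%C) : R[i]^o)); last first.
    exact: cvg_cexp_tail.
  apply/cvgnyPge => A; exists A => // i /= Ai.
  by rewrite (leq_trans Ai)// (leq_trans (leq_pmulr _ m_gt0))// leq_addl.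
have := ccvgD _ (cvg_cst (exp_kernel 0 s : R[i]^o)) (ccvgN _ T0).
move=> /(_ _ _ _); rewrite subr0; apply: cvg_trans; apply: near_eq_cvg.
apply: nearW => N.
rewrite /exp_kernel /T -mulrBr -sumrB /series /= big_mkord.
pose G q : R[i] :=
  s%:C%C ^+ (q + n) / (q + n)`!%:R * (m%:R^-1 * \sum_(l < m) lam l ^+ q).
transitivity (\sum_(q < N * m) G q); last first.
  rewrite sum_ord_multiples; last first.
    by move=> q mq; rewrite /G sum_char_root_ndvd// !mulr0.
  apply: eq_bigr => i _; rewrite /G sum_char_root_dvd// mulKf//.
  by rewrite mulrC mulrA.
rewrite subn0 big_distrr /=.
transitivity (\sum_(l < m) \sum_(q < N * m)
    (m%:R^-1 * (s%:C%C ^+ (q + n) / (q + n)`!%:R) * lam l ^+ q)).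
  apply: eq_bigr => l _; rewrite expr0 mul1r -mulrBr /cexp_tail opprB.
  rewrite addrC -addrA [X in _ + X]addrC addrAC.
  rewrite subrr sub0r.
  pose H p := (lam l * s%:C%C) ^+ p / p`!%:R.
  rewrite -(big_mkord predT H) -[X in _ - X](big_mkord predT H) /=.
  rewrite (big_cat_nat (leq0n _) (leq_addr _ _)) /= addrAC subrr add0r.
  have -> : \sum_(n <= i < n + N * m) H i = \sum_(q < N * m) H (q + n)%N.
    by rewrite -{1}[n]add0n [(n + _)%N]addnC big_addn addnK big_mkord.
  rewrite !big_distrr.
  apply: eq_bigr => q _ /=.
  rewrite /H [(_ * s%:C%C) ^+ _]exprMn [lam l ^+ (q + n)]exprD.
  have := expf_neq0 n (lam_neq0 l).
  move: (lam l ^+ n) => x x0.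
  rewrite -[RHS]mul1r -(mulVf x0).
  move: (m%:R^-1%R : R[i]) (x^-1%R) ((q + n)`!%:R^-1%R : R[i]) => A B C.
  by ring.
rewrite exchange_big; apply: eq_bigr => q _ /=.
rewrite -big_distrr /G /=; set z := \sum_(l < m) _.
by move: (m%:R^-1%R : R[i]) ((q + n)`!%:R^-1%R : R[i]) z => A B z; ring.
Qed.

End kernel_family.

(** All that the sequel uses about [zeta], in a form that covers [gamma = 0], where every root is 0
    and cannot be divided by. There [n = 1] and [k = 0], [zeta] is the identity, and the constant
    [E 1] is the exponential attached to the root 0. For [gamma = 0] and [n >= 2] the span property
    fails: [E 1 s] is [s ^ (n - 1) / (n - 1)!], while the root 0 contributes only constants and the
    monomials stop at degree [k - 1 < n - 1]. *)
Lemma kernel_familyP (R : realType) (n k : nat) (kn : (k < n)%N)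
    (gamma : R[i]) : gamma <> 0 \/ n = 1%N ->
  exists E : nat -> R -> R[i],
  [/\ E 0%N =1 zeta n k gamma,
      forall j s, has_cderiv setT (E j) s (E j.+1 s),
      forall j, (j <= n)%N -> E j 0 = (j == n)%:R,
      forall s, E n.+1 s = gamma * E k.+1 s &
      forall j, (0 < j <= n)%N -> exists c d : nat -> R[i], forall s, E j s =
        \sum_(l < n - k) c l * cexp (char_root (n - k) gamma l * s%:C%C) +
        \sum_(p < k) d p * s%:C%C ^+ p].
Proof.
have [->|g0 _] := eqVneq gamma 0; last first.
  exists (exp_kernel n k gamma); split.
  - by move=> s; rewrite exp_kernel_zeta.
  - by move=> j s; exact: has_cderiv_exp_kernel.
  - by move=> j; exact: exp_kernel_at0.
  - by move=> s; exact: exp_kernel_ode.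
  - by move=> j; exact: exp_kernel_span.
move=> [//|n1]; move: kn; rewrite {}n1; case: k => // _.
exists (fun j s =>
  if j is j'.+1 then (if j' is _.+1 then 0 else 1) else s%:C%C).
split.
- move=> s; apply/esym; apply: (@field_cvg_lim R[i]).
  (* With [gamma = 0] only the term of index 0 is nonzero, so the partial sums are constant from
     [N = 1] on. *)
  apply: cvg_near_cst; exists 1%N => // -[//|N] _.
  rewrite /series /= big_mkord big_ord_recl /= expr0 mul1r mul0n add0n expr1.
  rewrite divr1.
  by rewrite big1 ?addr0// => i _; rewrite exprS !mul0r.
- move=> [|[|j]] s; [exact: has_cderiv_id|exact: has_cderiv_cst..].
- by move=> [|[|j]].
- by move=> s; rewrite mul0r.
- move=> [|[|j]]// _; exists (fun=> 1), (fun=> 0) => s.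
  rewrite big_ord0 addr0 subn0 big_ord_recl big_ord0 addr0 mul1r.
  by rewrite /char_root rootC0 !mul0r cexp0.
Qed.

(** * Integration of complex-valued functions *)

Section bounded_measurable.
Context (R : realType) d (T : measurableType d).
Implicit Types (D : set T) (h g : T -> R[i]).

(** On sets of finite measure this implies integrability and, unlike integrability, it is stable
    under products. *)
Definition bmeas D h :=
  [/\ measurable_fun D (fun x => complex.Re (h x)),
      measurable_fun D (fun x => complex.Im (h x)) &
      exists M, forall x, D x -> cnorm1 (h x) <= M].

Lemma bmeasD D h g : bmeas D h -> bmeas D g -> bmeas D (fun x => h x + g x).
Proof.
move=> [h1 h2 [M hM]] [g1 g2 [N gN]]; split.
- have -> : (fun x => complex.Re (h x + g x)) =
      (fun x => complex.Re (h x) + complex.Re (g x)).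
    by apply/funext => x; rewrite raddfD.
  exact: measurable_funD.
- have -> : (fun x => complex.Im (h x + g x)) =
      (fun x => complex.Im (h x) + complex.Im (g x)).
    by apply/funext => x; rewrite raddfD.
  exact: measurable_funD.
- exists (M + N) => x Dx; apply: le_trans (cnorm1D _ _) _.
  by rewrite lerD// ?hM// gN.
Qed.

Lemma bmeasM D h g : bmeas D h -> bmeas D g -> bmeas D (fun x => h x * g x).
Proof.
move=> [h1 h2 [M hM]] [g1 g2 [N gN]]; split.
- under eq_fun do rewrite ReM.
  by apply: measurable_funB; apply: measurable_funM.
- under eq_fun do rewrite ImM.
  by apply: measurable_funD; apply: measurable_funM.
- exists (M * N) => x Dx; apply: le_trans (cnorm1M _ _) _.
  by rewrite ler_pM ?cnorm1_ge0// ?hM// gN.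
Qed.

Lemma bmeas_cst D c : bmeas D (fun=> c).
Proof. by split; [exact: measurable_cst..|exists (cnorm1 c)]. Qed.

Lemma bmeasZ D c h : bmeas D h -> bmeas D (fun x => c * h x).
Proof. exact: bmeasM (bmeas_cst D c). Qed.

Lemma bmeasB D h g : bmeas D h -> bmeas D g -> bmeas D (fun x => h x - g x).
Proof.
move=> bh bg; have := bmeasD bh (bmeasZ (-1) bg); congr bmeas.
by apply/funext => x; rewrite mulN1r.
Qed.

Lemma bmeas_subset D D' h : measurable D -> D' `<=` D ->
  bmeas D h -> bmeas D' h.
Proof.
move=> mD DD [h1 h2 [M hM]]; split.
- exact: measurable_funS h1.
- exact: measurable_funS h2.
by exists M => x /DD; exact: hM.
Qed.

Lemma bmeas_restrict D h : measurable D -> bmeas D h ->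
  bmeas setT (fun x => if x \in D then h x else 0).
Proof.
move=> mD [h1 h2 [M hM]]; split.
- move/(measurable_restrictT _ mD): h1; congr measurable_fun.
  by apply/funext => x; rewrite patchE; case: ifP.
- move/(measurable_restrictT _ mD): h2; congr measurable_fun.
  by apply/funext => x; rewrite patchE; case: ifP.
- exists (Num.max M 0) => x _; case: ifPn => [/set_mem Dx|_].
    by rewrite le_max hM.
  by rewrite le_max /cnorm1 /= normr0 addr0 lexx orbT.
Qed.

Lemma eq_bmeas D h g : (forall x, D x -> h x = g x) -> bmeas D h -> bmeas D g.
Proof.
move=> hg [h1 h2 [M hM]]; split.
- by apply: eq_measurable_fun h1 => x /set_mem /hg ->.
- by apply: eq_measurable_fun h2 => x /set_mem /hg ->.
- by exists M => x Dx; rewrite -hg// hM.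
Qed.

Lemma bmeasT D h : bmeas setT h -> bmeas D h.
Proof. exact: bmeas_subset. Qed.

Lemma bounded_integrable (mu : {measure set T -> \bar R}) D (f : T -> R) M :
  measurable D -> (mu D < +oo)%E -> measurable_fun D f ->
  (forall x, D x -> `|f x| <= M) -> mu.-integrable D (EFin \o f).
Proof.
move=> mD muD mf fM; apply: measurable_bounded_integrable => //.
exists M; split; first exact: num_real.
by move=> y My x Dx; apply: le_trans (fM x Dx) (ltW My).
Qed.

Lemma bmeas_integrable (mu : {measure set T -> \bar R}) D h :
  measurable D -> (mu D < +oo)%E -> bmeas D h ->
  mu.-integrable D (EFin \o (fun x => complex.Re (h x))) /\
  mu.-integrable D (EFin \o (fun x => complex.Im (h x))).
Proof.
move=> mD muD [h1 h2 [M hM]]; split;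
  apply: (@bounded_integrable _ _ _ M) => // x Dx;
  by apply: le_trans (hM x Dx); rewrite /cnorm1 ?lerDl ?lerDr.
Qed.

Lemma Rintegral_eq0 (mu : {measure set T -> \bar R}) D (f : T -> R) :
  (forall x, f x = 0) -> \int[mu]_(x in D) f x = 0.
Proof.
move=> f0; rewrite /Rintegral; under eq_integral do rewrite f0.
by rewrite integral0.
Qed.

Definition crint (mu : {measure set T -> \bar R}) D h : R[i] :=
  Complex (\int[mu]_(x in D) complex.Re (h x))
          (\int[mu]_(x in D) complex.Im (h x)).

Lemma eq_crint (mu : {measure set T -> \bar R}) D h g :
  (forall x, D x -> h x = g x) -> crint mu D h = crint mu D g.
Proof.
move=> hg; rewrite /crint.
by congr Complex; apply: eq_Rintegral => x /set_mem /hg ->.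
Qed.

Lemma crintD (mu : {measure set T -> \bar R}) D h g :
  measurable D -> (mu D < +oo)%E -> bmeas D h -> bmeas D g ->
  crint mu D (fun x => h x + g x) = crint mu D h + crint mu D g.
Proof.
move=> mD muD /(bmeas_integrable mD muD)[h1 h2].
move=> /(bmeas_integrable mD muD)[g1 g2].
rewrite /crint; under eq_Rintegral do rewrite raddfD.
under [X in Complex _ X]eq_Rintegral do rewrite raddfD.
by rewrite !RintegralD.
Qed.

Lemma crintZ (mu : {measure set T -> \bar R}) D c h :
  measurable D -> (mu D < +oo)%E -> bmeas D h ->
  crint mu D (fun x => c * h x) = c * crint mu D h.
Proof.
move=> mD muD bh; have [h1 h2] := bmeas_integrable mD muD bh.
have Z (r : R) f : mu.-integrable D (EFin \o f) ->
    mu.-integrable D (EFin \o (fun x => r * f x)).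
  by move=> fi; exact: (integrableZl mD r fi).
rewrite /crint; under eq_Rintegral do rewrite ReM.
under [X in Complex _ X]eq_Rintegral do rewrite ImM.
rewrite RintegralB; [|by []|exact: Z|exact: Z].
rewrite RintegralD; [|by []|exact: Z|exact: Z].
rewrite !RintegralZl//; case: (c) => x y.
by rewrite /GRing.mul /=.
Qed.

Lemma crintB (mu : {measure set T -> \bar R}) D h g :
  measurable D -> (mu D < +oo)%E -> bmeas D h -> bmeas D g ->
  crint mu D (fun x => h x - g x) = crint mu D h - crint mu D g.
Proof.
move=> mD muD bh bg; rewrite -mulN1r -crintZ// -crintD//; last exact: bmeasZ.
by apply: eq_crint => x _; rewrite mulN1r.
Qed.

Lemma crint_mkcond (mu : {measure set T -> \bar R}) D D' h :
  measurable D -> measurable D' -> D' `<=` D ->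
  crint mu D (fun x => if x \in D' then h x else 0) = crint mu D' h.
Proof.
move=> mD mD' DD; rewrite /crint; congr Complex.
  rewrite -{2}(setIidr DD) Rintegral_mkcondr; apply: eq_Rintegral => x _.
  by rewrite patchE; case: ifP.
rewrite -{2}(setIidr DD) Rintegral_mkcondr; apply: eq_Rintegral => x _.
by rewrite patchE; case: ifP.
Qed.

End bounded_measurable.

Section crint_Fubini.
Context (R : realType) d1 d2 (T1 : measurableType d1) (T2 : measurableType d2).
Context (m1 : {sigma_finite_measure set T1 -> \bar R}).
Context (m2 : {sigma_finite_measure set T2 -> \bar R}).
Context (A : set T1) (B : set T2) (mA : measurable A) (mB : measurable B).
Context (m1A : (m1 A < +oo)%E) (m2B : (m2 B < +oo)%E).

Section real_function.
Context (f : T1 -> T2 -> R) (M : R).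
Hypothesis mf : measurable_fun setT (fun z : T1 * T2 => f z.1 z.2).
Hypothesis fM : forall x y, `|f x y| <= M.
Hypothesis f0 : forall x y, ~ (A x /\ B y) -> f x y = 0.

Let F (z : T1 * T2) : \bar R := (f z.1 z.2)%:E.

Let intF : (m1 \x m2)%E.-integrable setT F.
Proof.
have mAB : measurable (A `*` B) by exact: measurableX.
have -> : F = F \_ (A `*` B).
  apply/funext => -[x y]; rewrite patchE; case: ifPn => // /negP AB.
  by rewrite /F /= f0// => -[Ax By]; apply: AB; rewrite inE; split.
apply/(integrable_mkcond _ mAB).
apply: (@bounded_integrable R _ _ (m1 \x m2)%E (A `*` B)
  (fun z => f z.1 z.2) M) => //.
- have /= -> := @product_measure1E _ _ _ _ _ m1 m2 A B mA mB.
  by rewrite lte_mul_pinfty// ge0_fin_numE.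
- exact: measurable_funTS.
Qed.

Let int1 x : m2.-integrable setT (fun y => F (x, y)).
Proof.
have -> : (fun y => F (x, y)) = (EFin \o (f x)) \_ B.
  apply/funext => y; rewrite patchE; case: ifPn => // /negP yB.
  by rewrite /F /= f0// => -[_ By]; apply: yB; rewrite inE.
apply/(integrable_mkcond _ mB).
apply: (@bounded_integrable R _ _ m2 B (f x) M) => //.
apply: measurable_funTS.
exact: (measurableT_comp mf (pair1_measurable x)).
Qed.

Let int2 y : m1.-integrable setT (fun x => F (x, y)).
Proof.
have -> : (fun x => F (x, y)) = (EFin \o (f^~ y)) \_ A.
  apply/funext => x; rewrite patchE; case: ifPn => // /negP xA.
  by rewrite /F /= f0// => -[Ax _]; apply: xA; rewrite inE.
apply/(integrable_mkcond _ mA).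
apply: (@bounded_integrable R _ _ m1 A (f^~ y) M) => //.
apply: measurable_funTS.
exact: (measurableT_comp mf (pair2_measurable y)).
Qed.

(** As [f] vanishes off the rectangle, all integrals extend to the whole spaces, where Fubini's
    theorem applies. *)
Lemma Rintegral_Fubini :
  \int[m1]_(x in A) \int[m2]_(y in B) f x y =
  \int[m2]_(y in B) \int[m1]_(x in A) f x y.
Proof.
have e1 x : (\int[m2]_y F (x, y))%E = (\int[m2]_(y in B) f x y)%:E.
  rewrite -[LHS]fineK ?integrable_fin_num//; congr EFin.
  rewrite Rintegral_mkcond; congr fine; apply: eq_integral => y _.
  rewrite patchE; case: ifPn => // /negP yB.
  by rewrite /F /= f0// => -[_ By]; apply: yB; rewrite inE.
have e2 y : (\int[m1]_x F (x, y))%E = (\int[m1]_(x in A) f x y)%:E.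
  rewrite -[LHS]fineK ?integrable_fin_num//; congr EFin.
  rewrite Rintegral_mkcond; congr fine; apply: eq_integral => x _.
  rewrite patchE; case: ifPn => // /negP xA.
  by rewrite /F /= f0// => -[Ax _]; apply: xA; rewrite inE.
have := Fubini intF; under eq_integral do rewrite e1.
under [X in _ = X]eq_integral do rewrite e2.
move=> /(congr1 fine) h.
rewrite Rintegral_mkcond [RHS]Rintegral_mkcond.
rewrite [LHS](_ : _ = fine (\int[m1]_x (\int[m2]_(y in B) f x y)%:E)%E);
    last first.
  congr fine; apply: eq_integral => x _; rewrite patchE.
  case: ifPn => // /negP xA.
  rewrite [X in _ = X%:E]Rintegral_eq0// => y; rewrite f0// => -[Ax _].
  by apply: xA; rewrite inE.
rewrite h; congr fine; apply: eq_integral => y _; rewrite patchE.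
case: ifPn => // /negP yB.
rewrite [X in X%:E = _]Rintegral_eq0// => x; rewrite f0// => -[_ By].
by apply: yB; rewrite inE.
Qed.

Lemma measurable_Rintegral_section :
  measurable_fun setT (fun y => \int[m1]_(x in A) f x y).
Proof.
have := measurable_fubini_G intF.
move=> /(measurableT_comp (fine_measurable measurableT)); congr measurable_fun.
apply/funext => y /=; rewrite Rintegral_mkcond; congr fine.
apply: eq_integral => x _; rewrite patchE; case: ifPn => // /negP xA.
by rewrite /F /= f0// => -[Ax _]; apply: xA; rewrite inE.
Qed.

Lemma Rintegral_section_le y : `|\int[m1]_(x in A) f x y| <= M * fine (m1 A).
Proof.
have i2 : m1.-integrable A (EFin \o f^~ y).
  apply: (@bounded_integrable R _ _ m1 A (f^~ y) M) => //.
  apply: measurable_funTS.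
  exact: (measurableT_comp mf (pair2_measurable y)).
apply: le_trans (le_normr_Rintegral mA i2) _.
rewrite -Rintegral_cst//; apply: le_Rintegral => //.
- exact: integrable_norm.
- exact: (@bounded_integrable R _ _ m1 A (cst M) `|M|).
Qed.

End real_function.

Context (f : T1 -> T2 -> R[i]).
Hypothesis bf : bmeas setT (fun z : T1 * T2 => f z.1 z.2).
Hypothesis f0 : forall x y, ~ (A x /\ B y) -> f x y = 0.

Let M : R := projT1 (cid (let: And3 _ _ h := bf in h)).
Let bfM z : cnorm1 (f z.1 z.2) <= M.
Proof. by rewrite /M; case: cid => N /=; exact. Qed.

Let ReM x y : `|complex.Re (f x y)| <= M.
Proof. by apply: le_trans (bfM (x, y)); rewrite lerDl. Qed.

Let ImM x y : `|complex.Im (f x y)| <= M.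
Proof. by apply: le_trans (bfM (x, y)); rewrite lerDr. Qed.

Let Re0 x y : ~ (A x /\ B y) -> complex.Re (f x y) = 0.
Proof. by move=> /f0 ->. Qed.

Let Im0 x y : ~ (A x /\ B y) -> complex.Im (f x y) = 0.
Proof. by move=> /f0 ->. Qed.

Lemma crint_Fubini : crint m1 A (fun x => crint m2 B (f x)) =
  crint m2 B (fun y => crint m1 A (f^~ y)).
Proof.
have [h1 h2 _] := bf; rewrite /crint /=; congr Complex.
- exact: (Rintegral_Fubini h1 ReM Re0).
- exact: (Rintegral_Fubini h2 ImM Im0).
Qed.

Lemma bmeas_crint_section : bmeas setT (fun y => crint m1 A (f^~ y)).
Proof.
have [h1 h2 _] := bf; split.
- exact: (measurable_Rintegral_section h1 ReM Re0).
- exact: (measurable_Rintegral_section h2 ImM Im0).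
- exists (M * fine (m1 A) + M * fine (m1 A)) => y _.
  rewrite /cnorm1 /crint /= lerD//.
  + exact: (Rintegral_section_le h1 ReM).
  + exact: (Rintegral_section_le h2 ImM).
Qed.

End crint_Fubini.

(** * Integration by parts *)

Section continuous_functions.
Context (R : realType).
Implicit Types (f g : R -> R[i]).
Local Notation leb :=
  (@lebesgue_measure R : {measure set (measurableTypeR R) -> \bar R}).

Definition ccontinuous_on (D : set R) f :=
  {within D, continuous (f : R -> R[i]^o)}.

Lemma has_cderiv_ccontinuous (D : set R) f (df : R -> R[i]) :
  (forall t, D t -> has_cderiv D f t (df t)) -> ccontinuous_on D f.
Proof.
move=> hf; apply/subspace_continuousP => t Dt.
exact: (has_cderiv_continuous (hf t Dt)).
Qed.

Lemma ccontinuous_onRe D f : ccontinuous_on D f ->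
  {within D, continuous (fun t => complex.Re (f t))}.
Proof.
move=> /subspace_continuousP hf; apply/subspace_continuousP => t Dt.
exact: (cvg_complexRe _ (hf t Dt)).
Qed.

Lemma ccontinuous_onIm D f : ccontinuous_on D f ->
  {within D, continuous (fun t => complex.Im (f t))}.
Proof.
move=> /subspace_continuousP hf; apply/subspace_continuousP => t Dt.
exact: (cvg_complexIm _ (hf t Dt)).
Qed.

Lemma ccontinuous_onD D f g : ccontinuous_on D f -> ccontinuous_on D g ->
  ccontinuous_on D (fun t => f t + g t).
Proof.
move=> /subspace_continuousP hf /subspace_continuousP hg.
apply/subspace_continuousP => t Dt.
exact: (ccvgD _ (hf t Dt) (hg t Dt)).
Qed.

Lemma ccontinuous_onM D f g : ccontinuous_on D f -> ccontinuous_on D g ->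
  ccontinuous_on D (fun t => f t * g t).
Proof.
move=> /subspace_continuousP hf /subspace_continuousP hg.
apply/subspace_continuousP => t Dt.
exact: (ccvgM _ (hf t Dt) (hg t Dt)).
Qed.

Lemma ccontinuous_on_cst D c : ccontinuous_on D (fun=> c).
Proof. by apply/subspace_continuousP => t Dt; exact: cvg_cst. Qed.

Lemma ccontinuous_on_subset D D' f : D' `<=` D ->
  ccontinuous_on D f -> ccontinuous_on D' f.
Proof. by move=> DD; apply: continuous_subspaceW. Qed.

Lemma real_FTC (F f : R -> R) (a b : R) : a < b ->
  {within `[a, b], continuous f} -> {within `[a, b], continuous F} ->
  (forall t, a < t < b -> is_derive t 1 F (f t)) ->
  \int[@lebesgue_measure R]_(x in `[a, b]) f x = F b - F a.
Proof.
move=> ab cf cF dF.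
rewrite /Rintegral (@continuous_FTC2 R f F a b ab cf)//.
- have [_ h1 h2] := (continuous_within_itvP F ab).1 cF.
  split => // t; rewrite in_itv /= => /dF []//.
- move=> t; rewrite in_itv /= => /dF dFt; rewrite derive1E.
  exact: derive_val.
Qed.

(** At interior points the derivative relative to [[a, b]] is two-sided, and the endpoints need only
    continuity. The case [x = a] is apart because [real_FTC] is about nondegenerate intervals. *)
Lemma complex_FTC (F f : R -> R[i]) (a b x : R) : a <= x <= b ->
  ccontinuous_on `[a, b] f ->
  (forall t, a <= t <= b -> has_cderiv `[a, b] F t (f t)) ->
  crint leb `[a, x] f = F x - F a.
Proof.
move=> /andP[ax xb] cf dF; move: ax; rewrite le_eqVlt => /predU1P[<-|ax].
  by rewrite /crint set_itv1 !Rintegral_set1 subrr.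
have sub : `[a, x] `<=` `[a, b].
  by move=> t /=; rewrite !in_itv /= => /andP[-> /le_trans]; apply.
have cF : ccontinuous_on `[a, b] F.
  by apply: (@has_cderiv_ccontinuous _ _ f) => t /=; rewrite in_itv; exact: dF.
have dab t : a < t < x ->
    is_derive t 1 (fun s => complex.Re (F s)) (complex.Re (f t)) /\
    is_derive t 1 (fun s => complex.Im (F s)) (complex.Im (f t)).
  move=> /andP[at_ tx]; apply: (@has_cderiv_is_derive _ `[a, b]%classic).
    have tab : t \in `]a, b[ by rewrite in_itv /= at_ (lt_le_trans tx).
    apply: filterS (near_in_itvoo tab) => s /=; rewrite !in_itv /=.
    by move=> /andP[/ltW -> /ltW ->].
  by apply: dF; rewrite (ltW at_) (ltW (lt_le_trans tx _)).
have cf' := ccontinuous_on_subset sub cf.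
have cF' := ccontinuous_on_subset sub cF.
have e1 := real_FTC ax (ccontinuous_onRe cf') (ccontinuous_onRe cF')
  (fun t h => (dab t h).1).
have e2 := real_FTC ax (ccontinuous_onIm cf') (ccontinuous_onIm cF')
  (fun t h => (dab t h).2).
rewrite /crint e1 e2.
by case: (F x) (F a) => [? ?] [? ?].
Qed.

End continuous_functions.

Section representation.
Context (R : realType) (a b : R).
Context (n k : nat) (kn : (k < n)%N) (gamma : R[i]) (f : R -> R[i]).
Hypothesis fCn : Cn_on `[a, b] n f.
Context (E : nat -> R -> R[i]).
Hypothesis dE : forall j s, has_cderiv setT (E j) s (E j.+1 s).
Hypothesis E0 : forall j, (j <= n)%N -> E j 0 = (j == n)%:R.
Hypothesis E_ode : forall s, E n.+1 s = gamma * E k.+1 s.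
Local Notation D := (`[a, b]%classic : set R).
Local Notation fn i := (cderivn D i f).
Local Notation leb :=
  (@lebesgue_measure R : {measure set (measurableTypeR R) -> \bar R}).

Definition diff_op t := fn n t - gamma * fn k t.

Lemma has_cderiv_cderivn i t : (i < n)%N -> D t ->
  has_cderiv D (fn i) t (fn i.+1 t).
Proof.
by move=> i_n Dt; have [h _] := fCn; exact: (cderivableP (h i t i_n Dt)).
Qed.

Lemma ccontinuous_cderivn i : (i <= n)%N -> ccontinuous_on D (fn i).
Proof.
rewrite leq_eqVlt => /predU1P[->|i_n]; first exact: fCn.2.
by apply: has_cderiv_ccontinuous => t; exact: has_cderiv_cderivn.
Qed.

Lemma ccontinuous_diff_op : ccontinuous_on D diff_op.
Proof.
have -> : diff_op = fun t => fn n t + (- gamma) * fn k t.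
  by apply/funext => t; rewrite /diff_op mulNr.
apply: ccontinuous_onD; first exact: ccontinuous_cderivn.
apply: ccontinuous_onM; first exact: ccontinuous_on_cst.
by apply: ccontinuous_cderivn; exact: ltnW.
Qed.

(* The boundary terms of [N] integrations by parts of [E_1 (x - t) f^(N) t]: its
   derivative telescopes. *)
Definition bracket N x t := \sum_(j < N) E j.+1 (x - t) * fn (N.-1 - j) t.

Lemma has_cderiv_bracket N x t : (N <= n)%N -> D t ->
  has_cderiv D (bracket N x) t (E 1 (x - t) * fn N t - E N.+1 (x - t) * fn 0 t).
Proof.
move=> Nn Dt.
have h (j : 'I_N) : has_cderiv D (fun s => E j.+1 (x - s) * fn (N.-1 - j) s) t
    (E j.+1 (x - t) * fn (N - j) t - E j.+2 (x - t) * fn (N - j.+1) t).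
  have Nj : (N.-1 - j)%N = (N - j.+1)%N by rewrite -subn1 -subnDA add1n.
  have jN := ltn_ord j.
  have := has_cderivM (@has_cderiv_reflect R D _ x t _ (@dE j.+1 (x - t)))
    (@has_cderiv_cderivn (N.-1 - j) t _ Dt).
  move=> h; apply: has_cderiv_eq (h _) _ _ => //.
    by rewrite Nj; apply: leq_trans Nn; rewrite ltn_subrL (leq_trans _ jN).
  by rewrite Nj -subSn// subSS mulNr addrC.
have := @has_cderiv_sum R D t _ (index_enum 'I_N) predT _ _ (fun j _ => h j).
move=> {}h; apply: has_cderiv_eq h _ _ => //.
rewrite -(big_mkord predT (fun j => E j.+1 (x - t) * fn (N - j) t -
  E j.+2 (x - t) * fn (N - j.+1) t)).
under eq_bigr do rewrite -opprB.
rewrite sumrN.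
rewrite (@telescope_sumr _ 0 N (fun j => E j.+1 (x - t) * fn (N - j) t))//.
by rewrite opprB subn0 subnn.
Qed.

(** Among [E 1], ..., [E n] only [E n] is nonzero at 0: a shorter bracket vanishes on the diagonal,
    and for [N = n] the term [j = n - 1] leaves [f x]. *)
Lemma bracket_diag N x : (N <= n)%N -> bracket N x x = (N == n)%:R * f x.
Proof.
move=> Nn; rewrite /bracket subrr; case: N Nn => [|N] Nn.
  by rewrite big_ord0 ltn_eqF ?mul0r// (leq_ltn_trans _ kn).
rewrite big_ord_recr /= subnn big1 ?add0r ?E0// => j _.
have jn : (j.+1 < n)%N by apply: leq_trans Nn; rewrite ltnS ltn_ord.
by rewrite E0 ?(ltnW jn)// (ltn_eqF jn) mul0r.
Qed.

(** The derivative in [t] of [bracket n x t - gamma * bracket k x t] is the integrand, because the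
    two leftover terms in [f] itself cancel by [E_ode]. At the upper end [t = x] this combination
    equals [f x]. *)
Lemma representation x : D x ->
  f x = crint leb `[a, x] (fun t => E 1 (x - t) * diff_op t) +
    (bracket n x a - gamma * bracket k x a).
Proof.
rewrite /= in_itv /= => Dx.
have cE : ccontinuous_on D (fun t => E 1 (x - t)).
  apply: (@has_cderiv_ccontinuous _ _ _ (fun t => - E 2 (x - t))) => t _.
  exact: has_cderiv_reflect.
have -> := @complex_FTC R (fun t => bracket n x t - gamma * bracket k x t)
   (fun t => E 1 (x - t) * diff_op t) a b x Dx.
- rewrite subrK bracket_diag// bracket_diag ?(ltnW kn)// eqxx (ltn_eqF kn).
  by rewrite mul0r mulr0 subr0 mul1r.
- by apply: ccontinuous_onM cE ccontinuous_diff_op.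
- move=> t tab.
  have Dt : D t by rewrite /= in_itv.
  have := has_cderivB (@has_cderiv_bracket n x t (leqnn n) Dt)
    (@has_cderivZ R D gamma _ _ _ (@has_cderiv_bracket k x t (ltnW kn) Dt)).
  move=> h; apply: has_cderiv_eq h _ _ => //.
  by rewrite E_ode /diff_op; ring.
Qed.

End representation.

(** * Fubini's theorem for the convolution kernel *)

Lemma bmeas_comp (R : realType) d1 d2 (T1 : measurableType d1)
    (T2 : measurableType d2) (h : T2 -> R[i]) (phi : T1 -> T2) :
  measurable_fun setT phi -> bmeas setT h -> bmeas setT (fun x => h (phi x)).
Proof.
move=> mphi [h1 h2 [M hM]]; split.
- exact: (measurableT_comp h1 mphi).
- exact: (measurableT_comp h2 mphi).
- by exists M => x _; exact: hM.
Qed.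

Lemma ccontinuous_bmeas (R : realType) (a b : R) (h : R -> R[i]) :
  ccontinuous_on `[a, b] h ->
  bmeas (`[a, b]%classic : set (measurableTypeR R)) h.
Proof.
move=> ch; have c1 := ccontinuous_onRe ch; have c2 := ccontinuous_onIm ch.
have m := measurable_itv `[a, b].
split.
- exact: (subspace_continuous_measurable_fun m c1).
- exact: (subspace_continuous_measurable_fun m c2).
- have cpt := @segment_compact R a b.
  have /compact_bounded[M [_ hM]] := continuous_compact c1 cpt.
  have /compact_bounded[N [_ hN]] := continuous_compact c2 cpt.
  exists (M + 1 + (N + 1)) => x Dx; rewrite /cnorm1 lerD//.
    by apply: hM; [rewrite ltrDl|exists x].
  by apply: hN; [rewrite ltrDl|exists x].
Qed.

(** * Linearity of the integral for a complex measure *)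

Section cintegral_linear.
Context (R : realType) (mu : cmeasure R).
Local Notation T := (measurableTypeR R).
Local Notation jp nu := (jordan_pos (svalP (hahn_pair nu))).
Local Notation jn nu := (jordan_neg (svalP (hahn_pair nu))).

Lemma finite_measure_lty (nu : {finite_measure set T -> \bar R}) (D : set T) :
  measurable D -> (nu D < +oo)%E.
Proof. by move=> mD; rewrite ltey_eq fin_num_measure. Qed.

(** Linearity and Fubini's theorem are thereby reduced to four finite positive measures. *)
Lemma cintegralE (D : set T) (h : R -> R[i]) : cintegral mu D h =
  (crint (jp (cmeas_Re mu)) D h - crint (jn (cmeas_Re mu)) D h) +
  Complex 0 1 * (crint (jp (cmeas_Im mu)) D h - crint (jn (cmeas_Im mu)) D h).
Proof.
rewrite /cintegral /charge_integral /crint.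
apply/eqP; rewrite eq_complex /=; apply/andP; split; apply/eqP; ring.
Qed.

Lemma eq_cintegral (D : set T) (h g : R -> R[i]) :
  (forall x, D x -> h x = g x) -> cintegral mu D h = cintegral mu D g.
Proof.
move=> hg; rewrite !cintegralE.
by rewrite !(@eq_crint _ _ _ _ D h g hg).
Qed.

Lemma cintegralD (D : set T) (h g : R -> R[i]) : measurable D ->
  bmeas D h -> bmeas D g ->
  cintegral mu D (fun x => h x + g x) = cintegral mu D h + cintegral mu D g.
Proof.
move=> mD bh bg; rewrite !cintegralE.
rewrite !(@crintD _ _ _ _ D h g mD (finite_measure_lty _ mD) bh bg).
ring.
Qed.

Lemma cintegralZ (D : set T) c (h : R -> R[i]) : measurable D -> bmeas D h ->
  cintegral mu D (fun x => c * h x) = c * cintegral mu D h.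
Proof.
move=> mD bh; rewrite !cintegralE.
rewrite !(@crintZ _ _ _ _ D c h mD (finite_measure_lty _ mD) bh).
ring.
Qed.

Section null_functions.
Context (D : set T) (mD : measurable D).

(** Bounded measurability travels with the vanishing integral because additivity of [cintegral]
    relies on it; such functions form a vector space. *)
Definition cnull (h : R -> R[i]) := bmeas D h /\ cintegral mu D h = 0.

Lemma cnullD h g : cnull h -> cnull g -> cnull (fun x => h x + g x).
Proof.
move=> [bh h0] [bg g0]; split; first exact: bmeasD.
by rewrite cintegralD// h0 g0 addr0.
Qed.

Lemma cnullZ c h : cnull h -> cnull (fun x => c * h x).
Proof.
move=> [bh h0]; split; first by apply: bmeasM => //; exact: bmeas_cst.
by rewrite cintegralZ// h0 mulr0.
Qed.

Lemma eq_cnull h g : (forall x, h x = g x) -> cnull h -> cnull g.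
Proof. by move=> /funext ->. Qed.

Lemma cnull0 : cnull (fun=> 0).
Proof.
split; first exact: bmeas_cst.
rewrite -[RHS](mul0r (cintegral mu D (fun=> 0))) -cintegralZ//.
  by apply: eq_cintegral => x _; rewrite mul0r.
exact: bmeas_cst.
Qed.

Lemma cnull_sum (I : Type) (r : seq I) (h : I -> R -> R[i]) :
  (forall i, cnull (h i)) -> cnull (fun x => \sum_(i <- r) h i x).
Proof.
move=> h0; elim: r => [|i r IH].
  by apply: eq_cnull cnull0 => x; rewrite big_nil.
by apply: eq_cnull (cnullD (h0 i) IH) => x; rewrite big_cons.
Qed.

End null_functions.

End cintegral_linear.

Section kernel_Fubini.
Context (R : realType) (a b : R) (K u : R -> R[i]).
Local Notation T := (measurableTypeR R).
Local Notation D := (`[a, b]%classic : set T).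
Hypothesis cK : ccontinuous_on setT K.
Hypothesis bu : bmeas D u.
Local Notation leb := (@lebesgue_measure R).

Let mD : measurable D. Proof. exact: measurable_itv. Qed.
Let lebD : (leb D < +oo)%E.
Proof. exact/compact_finite_measure/segment_compact. Qed.

(** The Volterra kernel cut to the triangle [a <= t <= x <= b]: extension by zero turns both
    variable limits of integration into integrals over the square. *)
Let H (x t : T) : R[i] :=
  if [&& (a <= t), (t <= x) & (x <= b)] then K (x - t) else 0.

Let bH : bmeas setT (fun z : T * T => H z.1 z.2).
Proof.
have mS : measurable_fun setT
    (fun z : T * T => [&& (a <= z.2), (z.2 <= z.1) & (z.1 <= b)]).
  apply: measurable_and; first exact: measurable_fun_ler.
  by apply: measurable_and; exact: measurable_fun_ler.
have mB : measurable_fun setT (fun z : T * T => z.1 - z.2).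
  exact: measurable_funB.
have h1 : measurable_fun setT (fun x : T => complex.Re (K x)).
  apply: (@subspace_continuous_measurable_fun R setT) => //.
  exact: (ccontinuous_onRe cK).
have h2 : measurable_fun setT (fun x : T => complex.Im (K x)).
  apply: (@subspace_continuous_measurable_fun R setT) => //.
  exact: (ccontinuous_onIm cK).
split.
- under eq_fun do rewrite /H (fun_if (@complex.Re R)).
  apply: measurable_fun_ifT => //; exact: (measurableT_comp h1 mB).
- under eq_fun do rewrite /H (fun_if (@complex.Im R)).
  apply: measurable_fun_ifT => //; exact: (measurableT_comp h2 mB).
(* A continuous [K] may be unbounded on the line, but on the triangle [x - t] stays in the compact
   interval [[0, b - a]]. *)
- have [_ _ [M hM]] := ccontinuous_bmeas
    (@ccontinuous_on_subset R _ `[0, b - a] _ (fun x _ => I) cK).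
  exists (Num.max M 0) => -[x t] _; rewrite /H /=.
  case: ifP => [/and3P[at_ tx xb]|_].
    by rewrite le_max hM//= in_itv /= subr_ge0 tx lerB.
  by rewrite le_max /cnorm1 /= normr0 addr0 lexx orbT.
Qed.

Let G (x t : T) : R[i] := H x t * (if t \in D then u t else 0).

Let bG : bmeas setT (fun z : T * T => G z.1 z.2).
Proof.
apply: bmeasM => //.
apply: (@bmeas_comp _ _ _ _ _ (fun t => if t \in D then u t else 0) snd).
  exact: measurable_snd.
exact: bmeas_restrict.
Qed.

Let H0 (x t : T) : ~ (D x /\ D t) -> H x t = 0.
Proof.
move=> xt; rewrite /H; case: ifP => // /and3P[at_ tx xb]; case: xt.
by split; rewrite /= in_itv /= ?at_ ?xb ?(le_trans at_ tx) ?(le_trans tx xb).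
Qed.

Let G0 (x t : T) : ~ (D x /\ D t) -> G x t = 0.
Proof. by move=> /H0; rewrite /G => ->; rewrite mul0r. Qed.

Let crintG x : D x ->
  crint leb `[a, x] (fun t => K (x - t) * u t) = crint leb D (G x).
Proof.
rewrite /= in_itv /= => /andP[ax xb].
have sub : `[a, x]%classic `<=` D.
  by move=> t /=; rewrite !in_itv /= => /andP[-> /le_trans]; apply.
rewrite -(@crint_mkcond R _ T leb D `[a, x]%classic)//; apply: eq_crint => t Dt.
rewrite /G (mem_set Dt) /H xb andbT.
have -> : (t \in `[a, x]%classic) = (a <= t) && (t <= x).
  by rewrite mem_setE in_itv.
by case: ifP => // _; rewrite mul0r.
Qed.

(** Required for splitting the [mu]-integral of the representation of [f]. Since
    [bmeas_crint_section] integrates out the first variable, the variables of [G] are swapped. *)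
Lemma bmeas_kernel :
  bmeas D (fun x => crint leb `[a, x] (fun t => K (x - t) * u t)).
Proof.
apply: (@eq_bmeas _ _ _ _ (fun x => crint leb D (G x))).
  by move=> x Dx; rewrite crintG.
apply: bmeasT.
apply: (@bmeas_crint_section R _ _ T T leb leb D D mD mD lebD lebD
  (fun t x => G x t)).
  exact: (bmeas_comp (@measurable_swap _ _ T T) bG).
by move=> x y h; apply: G0 => -[? ?]; apply: h.
Qed.

Context (nu : {finite_measure set T -> \bar R}).

Let nuD : (nu D < +oo)%E. Proof. exact: finite_measure_lty. Qed.

Let crintH t : D t ->
  crint nu `[t, b] (fun x => K (x - t)) = crint nu D (H^~ t).
Proof.
rewrite /= in_itv /= => /andP[at_ tb].
have sub : `[t, b]%classic `<=` D.
  by move=> x /=; rewrite !in_itv /= => /andP[/(le_trans at_) -> ->].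
rewrite -(@crint_mkcond R _ T nu D `[t, b]%classic)//; apply: eq_crint => x Dx.
have -> : (x \in `[t, b]%classic) = (t <= x) && (x <= b).
  by rewrite mem_setE in_itv.
by rewrite /H at_.
Qed.

Lemma bmeas_dual_kernel :
  bmeas D (fun t => crint nu `[t, b] (fun x => K (x - t))).
Proof.
apply: (@eq_bmeas _ _ _ _ (fun t => crint nu D (H^~ t))).
  by move=> x Dx; rewrite crintH.
apply: bmeasT.
exact: (@bmeas_crint_section R _ _ T T nu leb D D mD mD nuD lebD H).
Qed.

Lemma kernel_Fubini :
  crint nu D (fun x => crint leb `[a, x] (fun t => K (x - t) * u t)) =
  crint leb D (fun t => u t * crint nu `[t, b] (fun x => K (x - t))).
Proof.
rewrite (eq_crint _ crintG).
rewrite (@crint_Fubini R _ _ T T nu leb D D mD mD nuD lebD G bG G0).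
apply: eq_crint => t Dt; rewrite crintH// /G mem_set//.
rewrite -crintZ//; last first.
  apply: bmeasT; exact: (bmeas_comp (pair2_measurable t) bH).
by apply: eq_crint => x _; rewrite mulrC.
Qed.

End kernel_Fubini.

Section cintegral_kernel_Fubini.
Context (R : realType) (a b : R) (K u : R -> R[i]) (mu : cmeasure R).
Local Notation T := (measurableTypeR R).
Local Notation D := (`[a, b]%classic : set T).
Hypothesis cK : ccontinuous_on setT K.
Hypothesis bu : bmeas D u.
Local Notation jp nu :=
  (jordan_pos (svalP (hahn_pair nu)) : {finite_measure set T -> \bar R}).
Local Notation jn nu :=
  (jordan_neg (svalP (hahn_pair nu)) : {finite_measure set T -> \bar R}).
Local Notation leb := (@lebesgue_measure R).

Let mD : measurable D. Proof. exact: measurable_itv. Qed.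
Let lebD : (leb D < +oo)%E.
Proof. exact/compact_finite_measure/segment_compact. Qed.

Lemma bmeas_cintegral_kernel :
  bmeas D (fun t => cintegral mu `[t, b] (fun x => K (x - t))).
Proof.
(* The placeholder is filled by the right-hand side of [cintegralE]. *)
apply: (@eq_bmeas _ _ _ _ (fun t => _)).
  by move=> t _; rewrite cintegralE; reflexivity.
have q nu := @bmeas_dual_kernel R a b K cK nu.
exact: (bmeasD (bmeasB (q (jp (cmeas_Re mu))) (q (jn (cmeas_Re mu))))
  (bmeasZ (Complex 0 1)
    (bmeasB (q (jp (cmeas_Im mu))) (q (jn (cmeas_Im mu)))))).
Qed.

Lemma cintegral_kernel_Fubini :
  cintegral mu D (fun x => crint leb `[a, x] (fun t => K (x - t) * u t)) =
  crint leb D (fun t => u t * cintegral mu `[t, b] (fun x => K (x - t))).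
Proof.
rewrite cintegralE !(kernel_Fubini cK bu).
pose p (nu : {finite_measure set T -> \bar R}) t :=
  u t * crint nu `[t, b] (fun x => K (x - t)).
have bp nu : bmeas D (p nu) by apply: bmeasM => //; exact: bmeas_dual_kernel.
have lin nu1 nu2 nu3 nu4 :
  (crint leb D (p nu1) - crint leb D (p nu2)) +
    Complex 0 1 * (crint leb D (p nu3) - crint leb D (p nu4)) =
  crint leb D
    (fun t => (p nu1 t - p nu2 t) + Complex 0 1 * (p nu3 t - p nu4 t)).
  rewrite -!crintB// -crintZ//; last exact: bmeasB.
  by rewrite -crintD//; [exact: bmeasB|exact: bmeasZ (bmeasB _ _)].
rewrite (lin (jp (cmeas_Re mu)) (jn (cmeas_Re mu))
             (jp (cmeas_Im mu)) (jn (cmeas_Im mu))).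
apply: eq_crint => t _; rewrite cintegralE /p.
by rewrite -!mulrBr mulrCA -mulrDr.
Qed.

End cintegral_kernel_Fubini.

(** * Functions annihilated by the measure *)

Section null_kernel.
Context (R : realType) (a b : R) (mu : cmeasure R).
Local Notation T := (measurableTypeR R).
Local Notation D := (`[a, b]%classic : set T).
Context (k m : nat) (lam : nat -> R[i]).
Let mD : measurable D. Proof. exact: measurable_itv. Qed.

Lemma ccontinuous_monomial (i : nat) :
  ccontinuous_on D (fun x => (x%:C%C : R[i]) ^+ i).
Proof.
apply: (@has_cderiv_ccontinuous _ _ _ (fun t => i%:R * t%:C%C ^+ i.-1)) => t _.
exact: has_cderivXn.
Qed.

Lemma ccontinuous_cexp (l : R[i]) :
  ccontinuous_on D (fun x => cexp (l * x%:C%C)).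
Proof.
apply: (@has_cderiv_ccontinuous _ _ _ (fun t => l * cexp (l * t%:C%C))) => t _.
exact: has_cderiv_cexp.
Qed.

Hypothesis moments : forall i : nat, (i < k)%N ->
  cintegral mu D (fun x => (x%:C%C : R[i]) ^+ i) = 0.
Hypothesis exps : forall j : nat, (j < m)%N ->
  cintegral mu D (fun x => cexp (lam j * x%:C%C)) = 0.

Let null_monomial (i : nat) : (i < k)%N ->
  cnull mu D (fun x => (x%:C%C : R[i]) ^+ i).
Proof.
move=> ik; split; last exact: moments.
by apply: ccontinuous_bmeas; exact: ccontinuous_monomial.
Qed.

Let null_exp j : (j < m)%N -> cnull mu D (fun x => cexp (lam j * x%:C%C)).
Proof.
move=> jm; split; last exact: exps.
by apply: ccontinuous_bmeas; exact: ccontinuous_cexp.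
Qed.

(** The span is invariant under translation: an exponential is multiplied by a constant, and the
    binomial formula only produces degrees [i <= p < k]. *)
Lemma null_translate (c d : nat -> R[i]) (F : R -> R[i]) (y : R) :
  (forall s, F s = \sum_(l < m) c l * cexp (lam l * s%:C%C) +
                   \sum_(p < k) d p * s%:C%C ^+ p) ->
  cnull mu D (fun x => F (x - y)).
Proof.
move=> FE; apply: (@eq_cnull _ _ _ (fun x =>
  \sum_(l < m) (c l * cexp (lam l * (- y)%:C%C)) * cexp (lam l * x%:C%C) +
  \sum_(p < k) \sum_(i < p.+1)
    d p * ((- y)%:C%C ^+ (p - i) *+ 'C(p, i)) * x%:C%C ^+ i)).
  move=> x; rewrite FE; congr (_ + _); apply: eq_bigr => l _.
    by rewrite -mulrA -cexpD -mulrDr -rmorphD [in RHS]addrC.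
  rewrite rmorphB addrC -rmorphN exprDn big_distrr; apply: eq_bigr => i _ /=.
  by rewrite -mulrnAl mulrA.
apply: cnullD => //; apply: cnull_sum => // l.
  by apply: cnullZ => //; exact: null_exp.
apply: cnull_sum => // i; apply: cnullZ => //; apply: null_monomial.
by apply: leq_trans (ltn_ord l); rewrite ltnS -ltnS.
Qed.

End null_kernel.

(** * Hoelder's inequality *)

Section integral_bounds.
Context (R : realType) d (T : measurableType d).
Context (mu : {measure set T -> \bar R}).
Context (D : set T) (mD : measurable D) (muD : (mu D < +oo)%E).

Lemma bmeas_cmod (E : set T) (h : T -> R[i]) :
  bmeas E h -> measurable_fun E (fun x => cmod (h x)).
Proof.
move=> [h1 h2 _].
have -> : (fun x => cmod (h x)) =
    (fun x => Num.sqrt (complex.Re (h x) ^+ 2 + complex.Im (h x) ^+ 2)).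
  by apply/funext => x; rewrite -cmod_sqr sqrtr_sqr ger0_norm// cmod_ge0.
apply: (measurableT_comp (f := @Num.sqrt R)).
  by apply: continuous_measurable_fun; exact: sqrt_continuous.
by apply: measurable_funD; exact: measurable_funX.
Qed.

Lemma cmod_integrable (h : T -> R[i]) : bmeas D h ->
  mu.-integrable D (EFin \o (fun x => cmod (h x))).
Proof.
move=> bh; have [_ _ [M hM]] := bh.
apply: (@bounded_integrable _ _ _ mu D _ M) => //; first exact: bmeas_cmod.
move=> x Dx; rewrite ger0_norm ?cmod_ge0//.
by rewrite (le_trans (cmod_le_cnorm1 _))// hM.
Qed.

(** With [c] the conjugate of the integral [I], [cmod I ^+ 2] is the integral of the real part of
    [c * h], hence at most [cmod I] times the integral of the modulus; then divide by [cmod I]. *)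
Lemma cmod_crint_le (h : T -> R[i]) : bmeas D h ->
  cmod (crint mu D h) <= \int[mu]_(x in D) cmod (h x).
Proof.
move=> bh; set I := crint mu D h.
have [->|I0] := eqVneq (cmod I) 0.
  by apply: Rintegral_ge0 => x _; exact: cmod_ge0.
have Ipos : 0 < cmod I by rewrite lt_neqAle eq_sym I0 cmod_ge0.
pose c := Complex (complex.Re I) (- complex.Im I).
have cI : cmod I ^+ 2 = complex.Re (c * I).
  by rewrite cmod_sqr ReM /= mulNr opprK -!expr2.
have cmodc : cmod c = cmod I.
  by apply/eqP; rewrite -(@eqrXn2 _ 2) ?cmod_ge0// !cmod_sqr /= sqrrN.
have bch := bmeasZ c bh.
rewrite -(ler_pM2l Ipos) -expr2 cI -crintZ// -RintegralZl//; last first.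
  exact: cmod_integrable.
change (\int[mu]_(x in D) complex.Re (c * h x) <=
  \int[mu]_(x in D) (cmod I * cmod (h x))).
apply: le_Rintegral => //.
- by have [] := bmeas_integrable mD muD bch.
- have := cmod_integrable bch; congr integrable.
  by apply/funext => x /=; rewrite cmodM cmodc.
- move=> x Dx; rewrite -cmodc -cmodM; apply: le_trans (ler_norm _) _.
  exact: Re_le_cmod.
Qed.

Lemma crint_ge0 (h : T -> R[i]) :
  (forall x, D x -> 0 <= h x) -> 0 <= crint mu D h.
Proof.
move=> h0; rewrite complex_ge0E /=; apply/andP; split.
  rewrite -(@Rintegral_eq0 _ _ _ mu D (fun=> 0))//.
  apply/eqP/eq_Rintegral => x /set_mem /h0.
  by rewrite complex_ge0E => /andP[/eqP].
apply: Rintegral_ge0 => x /h0.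
by rewrite complex_ge0E => /andP[].
Qed.

End integral_bounds.

Section Lnorm_monotone.
Context (R : realType) d (T : measurableType d).
Context (mu : {measure set T -> \bar R}).
Local Open Scope ereal_scope.

(* No measurability is assumed, as [f] is arbitrary outside [[a, b]]: the
   integral of a nonnegative function is a supremum over the simple functions
   below it. *)
Lemma ge0_le_integral_nonmeasurable (f g : T -> \bar R) :
  (forall x, 0 <= f x) -> (forall x, f x <= g x) ->
  \int[mu]_x f x <= \int[mu]_x g x.
Proof.
move=> f0 fg; have g0 x : 0 <= g x by apply: le_trans (fg x).
rewrite !ge0_integralTE//; apply: le_ereal_sup => _ [h hf <-].
by exists h => // x; apply: le_trans (fg x); exact: hf.
Qed.

Lemma le_Lnorm (p : \bar R) (f g : T -> R) : 1 <= p ->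
  (forall x, (0 <= f x <= g x)%R) ->
  Lnorm mu p (EFin \o f) <= Lnorm mu p (EFin \o g).
Proof.
move=> p1 fg.
have f0 x : (0 <= f x)%R by case/andP: (fg x).
have g0 x : (0 <= g x)%R by case/andP: (fg x) => /le_trans; apply.
have fgle x : (f x <= g x)%R by case/andP: (fg x).
case: p p1 => [r| |//]; rewrite unlock /=.
- rewrite lee_fin => r1; have r0 : (0 < r)%R by apply: lt_le_trans r1.
  have I0 (h : T -> R) : 0 <= \int[mu]_x (`|h x| `^ r)%:E.
    by apply: integral_ge0 => x _; rewrite lee_fin powR_ge0.
  apply: gt0_ler_poweR.
  + by rewrite invr_ge0 ltW.
  + by rewrite in_itv /= I0 leey.
  + by rewrite in_itv /= I0 leey.
  + apply: ge0_le_integral_nonmeasurable => x.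
      by rewrite lee_fin powR_ge0.
    rewrite lee_fin ge0_ler_powR ?(ltW r0)// ?nnegrE//.
    by rewrite !ger0_norm.
- move=> _; case: ifPn => // _; apply: ess_sup_inf.le_ess_sup.
  apply: nearW => x /=.
  by rewrite lee_fin !ger0_norm.
Qed.

End Lnorm_monotone.

Section hoelder_extended.
Context (R : realType) d (T : measurableType d).
Context (mu : {measure set T -> \bar R}).
Local Open Scope ereal_scope.
Local Notation "'N_ p [ f ]" := (Lnorm mu p (EFin \o f)).
Implicit Types f g : T -> R.

(** Positivity of [mu setT] selects the essential supremum in the definition of the norm; the bound
    [C] makes it finite, so that it moves out of the integral as a scalar. *)
Lemma hoelder_infty f g (C : R) : 0 < mu setT ->
  measurable_fun setT f -> measurable_fun setT g ->
  (forall x, (`|g x| <= C)%R) ->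
  'N_1[(f \* g)%R] <= 'N_1[f] * 'N_+oo[g].
Proof.
move=> mu0 mf mg gC.
rewrite !Lnorm1 unlock /= mu0.
set s := ess_sup_inf.ess_sup _ _.
have sC : s <= C%:E.
  by apply/ess_sup_inf.ess_supP; apply: nearW => x /=; rewrite lee_fin.
have s0 : 0 <= s.
  by apply: ess_sup_inf.ess_sup_gee => //; apply: nearW => x /=.
have gs : {ae mu, forall x, `|(g x)%:E| <= s}.
  exact: (@ess_sup_inf.ess_sup_ge _ _ _ mu (abse \o (EFin \o g))).
have sfin : s \is a fin_num by rewrite ge0_fin_numE// (le_lt_trans sC)// ltry.
clearbody s; case: s sfin sC s0 gs => // s _ sC s0 gs.
rewrite muleC -ge0_integralZl//; last first.
- by apply/measurable_EFinP; exact: measurableT_comp.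
apply: ae_ge0_le_integral => //.
- apply/measurable_EFinP; apply: measurableT_comp => //.
  exact: measurable_funM.
- by move=> x _; rewrite mule_ge0.
- apply: emeasurable_funM; first exact: measurable_cst.
  by apply/measurable_EFinP; exact: measurableT_comp.
- apply: filterS gs => x /= gs _.
  by rewrite normrM EFinM muleC lee_wpmul2r// lee_fin.
Qed.

Lemma hoelder_extended f g (C C' : R) (p q : \bar R) : 0 < mu setT ->
  measurable_fun setT f -> measurable_fun setT g ->
  (forall x, (`|f x| <= C)%R) -> (forall x, (`|g x| <= C')%R) ->
  1 <= p -> 1 <= q -> p^-1 + q^-1 = 1 ->
  'N_1[(f \* g)%R] <= 'N_p[f] * 'N_q[g].
Proof.
move=> mu0 mf mg fC gC p1 q1 pq.
have pNy : -oo < p by rewrite (lt_le_trans _ p1)// ltNyr.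
have p0 : p != 0 by rewrite gt_eqF// (lt_le_trans _ p1).
have qE := (hoelder_conjugateP q pNy p0).1 pq.
have [py|py] := eqVneq p +oo.
  rewrite qE py hoelder_conjugatey muleC.
  under eq_Lnorm => x do rewrite /= mulrC.
  exact: (hoelder_infty mu0 mg mf fC).
have [pe1|pn1] := eqVneq p 1.
  by rewrite qE pe1 hoelder_conjugate1; exact: (hoelder_infty mu0 mf mg gC).
(* An infinite [q] would force [p = 1], which is excluded at this point. *)
have [qy|qy] := eqVneq q +oo.
  move: pq; rewrite qy invey adde0 => /eqP; rewrite inve_eq1 => /eqP pe.
  by rewrite pe eqxx in pn1.
case: p q p1 q1 pq {pNy} p0 {qE} py {pn1} qy => [p| |] [q| |]//.
rewrite !lee_fin => p1 q1 pq _ _ _.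
have pp : (0 < p)%R by apply: lt_le_trans p1.
have qp : (0 < q)%R by apply: lt_le_trans q1.
apply: hoelder => //.
by move: pq; rewrite !inver !gt_eqF// -EFinD => -[].
Qed.

End hoelder_extended.

Section Lnorm_restriction.
Context (R : realType) (a b : R) (ab : a < b).
Local Notation T := (measurableTypeR R).
Local Notation D := (`[a, b]%classic : set T).
Local Notation leb := (@lebesgue_measure R).
Let mD : measurable D. Proof. exact: measurable_itv. Qed.
Local Notation m := (mrestr leb (measurable_itv `[a, b])).

Let m_gt0 : (0 < m setT)%E.
Proof.
rewrite /mrestr setTI lebesgue_measure_itv /= lte_fin ab -EFinD.
by rewrite lte_fin subr_gt0.
Qed.

Lemma crint_hoelder (u g : R -> R[i]) (p q : \bar R) : bmeas D u -> bmeas D g ->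
  (1 <= p)%E -> (1 <= q)%E -> (p^-1 + q^-1 = 1)%E ->
  ((cmod (crint leb D (fun t => u t * g t)))%:E <=
    cLnorm a b p u * cLnorm a b q g)%E.
Proof.
move=> bu bg p1 q1 pq.
(* [u] need not be measurable outside [D], hence the truncation. *)
pose tr (h : R -> R[i]) : T -> R := fun t => cmod (if t \in D then h t else 0).
have cmod0 : cmod (0 : R[i]) = 0 by rewrite /cmod /= !expr0n addr0 sqrtr0.
have mtr h : bmeas D h -> measurable_fun setT (tr h).
  by move=> bh; apply: bmeas_cmod; exact: bmeas_restrict.
have btr h : bmeas D h -> exists C, forall x, `|tr h x| <= C.
  move=> bh; have [_ _ [C hC]] := bmeas_restrict mD bh; exists C => x.
  by rewrite ger0_norm ?cmod_ge0// (le_trans (cmod_le_cnorm1 _))// hC.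
have trle h x : 0 <= tr h x <= cmod (h x).
  by rewrite cmod_ge0 /tr; case: ifP => _; rewrite ?lexx// cmod0 cmod_ge0.
have lebD : (leb D < +oo)%E by exact/compact_finite_measure/segment_compact.
(* Truncation only lowers the modulus, so the norms of the truncated functions are bounded by those
   in the statement. *)
apply: (@le_trans _ _
    (Lnorm m p (EFin \o tr u) * Lnorm m q (EFin \o tr g))%E); last first.
  by apply: lee_pmul; rewrite ?Lnorm_ge0//; apply: le_Lnorm.
have [C uC] := btr _ bu; have [C' gC] := btr _ bg.
apply: le_trans (hoelder_extended m_gt0 (mtr _ bu) (mtr _ bg) uC gC p1 q1 pq).
have bug := bmeasM bu bg.
apply: (@le_trans _ _ (\int[leb]_(x in D) cmod (u x * g x))%:E).
  by rewrite lee_fin; exact: cmod_crint_le.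
rewrite /Rintegral fineK; last first.
  apply: integrable_fin_num => //; exact: cmod_integrable.
rewrite Lnorm1 le_eqVlt; apply/orP; left; apply/eqP.
rewrite (@eq_measure_integral _ _ _ D m leb); last first.
  by move=> A mA AD; rewrite /= /mrestr setIidl.
rewrite integral_mkcond; apply: eq_integral => x _.
rewrite patchE /= /tr; case: ifP => _.
  by rewrite cmodM ger0_norm// mulr_ge0// cmod_ge0.
by rewrite cmod0 mul0r normr0.
Qed.

End Lnorm_restriction.

(** * The kernel formula for the integral and its consequences *)

Theorem corollary3p4 (R : realType) (a b : R) (ab : a < b)
    (mu : cmeasure R)
    (mu_on : forall A : set (measurableTypeR R),
       measurable A -> A `&` `[a, b] = set0 -> mu A = 0)
    (mu_neq0 : exists A : set (measurableTypeR R), measurable A /\ mu A <> 0)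
    (n k : nat) (kn : (k < n)%N) (gamma : R[i])
    (gamma_or_n : gamma <> 0 \/ n = 1%N)
    (mu_moments : forall i : nat, (i < k)%N ->
       cintegral mu `[a, b] (fun x => (x%:C%C : R[i]) ^+ i) = 0)
    (mu_exps : forall j : nat, (j < n - k)%N ->
       cintegral mu `[a, b] (fun x =>
         cexp ((n - k).-root gamma
               * cexp (Complex 0 (2 * j%:R * pi / (n - k)%:R)) * x%:C%C)) = 0) :
  forall f : R -> R[i], Cn_on `[a, b] n f ->
    let g := gfun mu b n k gamma in
    let Lf t := cderivn `[a, b] n f t - gamma * cderivn `[a, b] k f t in
    let If := cintegral mu `[a, b] f in
    (forall p q : \bar R, (1 <= p)%E -> (1 <= q)%E -> (p^-1 + q^-1 = 1)%E ->
       ((cmod If)%:E <= cLnorm a b p Lf * cLnorm a b q g)%E) /\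
    (complex.Im gamma = 0 ->
     (forall A : set (measurableTypeR R), measurable A ->
        complex.Im (mu A) = 0) ->
     ((((forall t, `[a, b]%classic t -> 0 <= g t) /\
        (forall t, `[a, b]%classic t -> 0 <= Lf t)) \/
       ((forall t, `[a, b]%classic t -> g t <= 0) /\
        (forall t, `[a, b]%classic t -> Lf t <= 0))) -> 0 <= If) /\
     ((((forall t, `[a, b]%classic t -> 0 <= g t) /\
        (forall t, `[a, b]%classic t -> Lf t <= 0)) \/
       ((forall t, `[a, b]%classic t -> g t <= 0) /\
        (forall t, `[a, b]%classic t -> 0 <= Lf t))) -> If <= 0)).
Proof.
move=> f fCn g Lf If.
have [E [E_zeta dE E0 E_ode E_span]] := kernel_familyP kn gamma_or_n.
have mD : measurable (`[a, b]%classic : set (measurableTypeR R)).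
  exact: measurable_itv.
have exps j : (j < n - k)%N -> cintegral mu `[a, b]
    (fun x => cexp (char_root (n - k) gamma j * x%:C%C)) = 0.
  by move=> /mu_exps; rewrite /char_root unityX.
have E_null j : (0 < j <= n)%N ->
    cnull mu `[a, b]%classic (fun x => E j (x - a)).
  by move=> /E_span [c [d]]; exact: (null_translate mu_moments exps).
have cE1 : ccontinuous_on setT (E 1%N).
  by apply: (@has_cderiv_ccontinuous _ _ _ (E 2%N)) => t _; exact: dE.
have bLf : bmeas (`[a, b]%classic : set (measurableTypeR R)) Lf.
  by apply: ccontinuous_bmeas; apply: ccontinuous_diff_op.
(* In [gfun] the derivative of [zeta] is two-sided, so it is [E 1] at every point, including
   [x = t]. *)
have gE t : g t = cintegral mu `[t, b] (fun x => E 1%N (x - t)).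
  apply: eq_cintegral => x _; apply: has_cderiv_cderiv.
  by rewrite -(funext E_zeta); exact: dE.
have bg : bmeas (`[a, b]%classic : set (measurableTypeR R)) g.
  by rewrite (funext gE); exact: bmeas_cintegral_kernel.
pose leb : {measure set (measurableTypeR R) -> \bar R} := @lebesgue_measure R.
have IfE : If = crint leb
    `[a, b] (fun t => Lf t * g t).
  (* As a function of [x], the boundary term at [t = a] combines the [E j.+1 (x - a)] with
     [1 <= j + 1 <= n]; the coefficients are derivatives of [f] at [a]. *)
  have bracket_null N : (N <= n)%N ->
      cnull mu `[a, b]%classic (fun x => bracket a b f E N x a).
    move=> Nn; apply: cnull_sum => // j; apply: (@eq_cnull _ _ _ (fun x =>
      cderivn `[a, b] (N.-1 - j) f a * E j.+1 (x - a))).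
      by move=> x; rewrite mulrC.
    by apply: cnullZ => //; apply: E_null; rewrite /= (leq_trans (ltn_ord j)).
  have [br r0] : cnull mu `[a, b]%classic
      (fun x => bracket a b f E n x a + - gamma * bracket a b f E k x a).
    apply: cnullD => //; first exact: bracket_null.
    by apply: cnullZ => //; apply: bracket_null; exact: ltnW.
  rewrite /If (@eq_cintegral _ mu _ f (fun x =>
    crint leb
      `[a, x] (fun t => E 1%N (x - t) * Lf t) +
    (bracket a b f E n x a + - gamma * bracket a b f E k x a))); last first.
    by move=> x Dx; rewrite mulNr; exact: representation Dx.
  rewrite cintegralD//; last exact: bmeas_kernel.
  rewrite r0 addr0.
  apply: etrans (@cintegral_kernel_Fubini R a b (E 1%N) Lf mu cE1 bLf) _.
  by apply: eq_crint => t _; rewrite gE.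
rewrite IfE; split=> [p q p1 q1 pq|_ _]; first exact: crint_hoelder.
have lebD : (@lebesgue_measure R `[a, b]%classic < +oo)%E.
  exact/compact_finite_measure/segment_compact.
have neg : (forall t, `[a, b]%classic t -> Lf t * g t <= 0) ->
    crint leb
      `[a, b] (fun t => Lf t * g t) <= 0.
  move=> h0; rewrite -oppr_ge0 -mulN1r -crintZ//; last exact: bmeasM.
  by apply: crint_ge0 => t Dt; rewrite mulN1r oppr_ge0 h0.
(* A comparison with 0 in [R[i]] includes being real, so the product [Lf t * g t] is real with the
   sign given by the rule of signs. *)
split=> -[[g0 L0]|[g0 L0]].
- by apply: crint_ge0 => t Dt; rewrite mulr_ge0 ?L0 ?g0.
- by apply: crint_ge0 => t Dt; rewrite mulr_le0 ?L0 ?g0.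
- by apply: neg => t Dt; rewrite mulr_le0_ge0 ?L0 ?g0.
- by apply: neg => t Dt; rewrite mulr_ge0_le0 ?L0 ?g0.
Qed.
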